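(* Let $n\ge1$, let $\boldsymbol N=(N_1,\dots,N_n)$ be nonnegative integers, and let $a,b,c,d,e,x_1,\dots,x_n$ be complex parameters. Then \begin{align*} &\sum_{\substack{0\le k_r\le N_r\\ r=1,\dots,n}}\Bigg(\prod_{1\le r<s\le n}\frac{\theta(q^{k_r-k_s}x_r/x_s;p)}{\theta(x_r/x_s;p)}\prod_{r,s=1}^n\frac{(q^{-N_s}x_r/x_s;q,p)_{k_r}}{(qx_r/x_s;q,p)_{k_r}}\\ &\quad\times\frac{\theta(aq^{2|\boldsymbol k|};p)}{\theta(a;p)}\frac{(a,\,b,\,c,\,d,\,a^2q^{1+|\boldsymbol N|}/(bcd);q,p)_{|\boldsymbol k|}}{(aq^{|\boldsymbol N|+1},\,aq/b,\,aq/c,\,aq/d,\,bcdq^{-|\boldsymbol N|}/a;q,p)_{|\boldsymbol k|}}\\ &\quad\times\prod_{r=1}^n\frac{(ex_rq^{|\boldsymbol N|};q,p)_{k_r}(ex_r;q,p)_{|\boldsymbol k|}}{(ex_r;q,p)_{k_r}(ex_rq^{N_r};q,p)_{|\boldsymbol k|}}\;q^{\sum_{r=1}^n rk_r}\Bigg)\\ &=\frac{(aq,\,aq/(bc),\,aq/(bd),\,aq/(cd);q,p)_{|\boldsymbol N|}}{(aq/b,\,aq/c,\,aq/d,\,aq/(bcd);q,p)_{|\boldsymbol N|}}. \end{align*}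
   Context: Let $q,p$ be complex numbers with $q\neq 0$ and $|p|<1$. For $a\ne 0$ put $\theta(a;p)=\prod_{j\ge 0}(1-ap^j)(1-p^{j+1}/a)$. For an integer $k\ge 0$ the $q,p$-shifted factorial is $(a;q,p)_k=\prod_{j=0}^{k-1}\theta(aq^j;p)$ (empty product $=1$). Write $(a_1,\dots,a_m;q,p)_k=(a_1;q,p)_k\cdots(a_m;q,p)_k$. For a tuple $\boldsymbol k=(k_1,\dots,k_n)$, $|\boldsymbol k|=k_1+\cdots+k_n$. All parameters are nonzero and generic in the sense that no denominators in the formula vanish. *)

(* Defs.v *)
From mathcomp Require Export all_boot all_order all_algebra.
From mathcomp Require Export complex.
From mathcomp Require Export all_classical all_reals all_analysis.

Set Implicit Arguments.
Unset Strict Implicit.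
Unset Printing Implicit Defensive.

Export Order.TTheory GRing.Theory Num.Theory.
Export numFieldNormedType.Exports.

Local Open Scope ring_scope.

(* Stated over a numFieldType because the norm topology is attached to that
   structure; on [R[i]] it is the topology of the modulus.  The limit exists
   when [`|p| < 1] and [a != 0]. *)
Definition theta (K : numFieldType) (a p : K) : K :=
  limn (fun m : nat =>
    \prod_(0 <= j < m) ((1 - a * p ^+ j) * (1 - p ^+ j.+1 / a))).

Definition qpfact (K : numFieldType) (a q p : K) (k : nat) : K :=
  \prod_(0 <= j < k) theta (a * q ^+ j) p.

Definition qpfacts (K : numFieldType) (s : seq K) (q p : K) (k : nat) : K :=
  \prod_(a <- s) qpfact a q p k.

Definition weight (n : nat) (k : 'I_n -> nat) : nat := (\sum_(r < n) k r)%N.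

(* Main.v *)
Require Import Defs.
From mathcomp Require Import ring lra zify.
Local Open Scope ring_scope.
Local Open Scope complex_scope.

Set Implicit Arguments.
Unset Strict Implicit.
Unset Printing Implicit Defensive.

(** The multiple sum factors through two simpler summations.  Fix [K] and
    collect the terms with [|k| = K].  Everything that depends on [k] only
    through [K] comes out, and what remains is the sum over the simplex
    [|k| = K] that carries the Vandermonde type product; it has the closed
    form
      prod_(al) (b / al)_K / ((q)_K prod_j (b z_j)_K),  b = prod al prod z,
    for any [n + 1] numerator parameters [al] ([rosengren_sum]).  Here
    [al] runs over [e q^|N|] and the [q^-N_s / x_s], so that [b = e]; the closed
    form cancels the factors with [e] in the summand, and the outer sum over [K]
    is the classical one-variable Frenkel-Turaev sum ([frenkel_turaev_sum]).

    Both summations are proved over an arbitrary field, for any function [th]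
    that behaves like theta: [th 1 = 0], [th (1/z) = - th z / z], zeros are
    stable under quotients, and Weierstrass' three-term relation holds
    ([theta_like]).  The three-term relation gives the partial fraction
    identity for [n] points ([partial_fractions]) by induction on [n].  Applied
    twice, that identity gives the induction on [K] for the simplex sum: once to
    write 1 as a sum over [i] of terms that vanish for [k_i = 0], and once more,
    after the substitution [k = m + e_i], to sum over [i].  The Frenkel-Turaev
    sum is proved by induction on [N], from a relation between the sums with
    parameters [(N; a, b, c, d)] and [(N - 1; a q^2, b q, c q, d q)]; the relation
    between the summands and that between the right hand sides are both instances
    of the three-term relation.

    The three-term relation for theta itself comes from Jacobi's triple product.
    Expanding [theta (x y) theta (x / y)] as a double series in
    [x^(m+n) y^(m-n)] and separating the terms by the parity of [m + n]
    shows that it is a sum of two products of a function of [x] by a function of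
    [y].  Hence its 3 x 3 minors vanish ([theta_minor]), and since
    [theta (x y) theta (x / y) / x] is antisymmetric, so does its Pfaffian, which
    is the three-term relation.

    These arguments divide by theta values other than the denominators of the
    formula.  (For instance [(q)_K] with [K <= |N|] vanishes when [q] is a root of
    unity of small order, while the formula only contains [(q)_k] with
    [k <= N_r].)  They therefore prove the formula for generic parameters.  The
    general case follows by continuity: moving the parameters along
    [q g, a g^(|N|+1), e g, x_r g^((|N|+1) r)] with [g] decreasing to 1, every theta
    value that has to be nonzero has an argument [z g^l] with [l] nonzero, so it
    does not vanish for [g] close to 1 ([theta_pert]). *)

(** * Limits of sequences, the modulus, and infinite products *)
Section Tends.
Local Open Scope classical_set_scope.
Variable K : numFieldType.
Implicit Types (u v : nat -> K) (l : K).

(** A wrapper around convergence at infinity: hiding the filter inclusion behind a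
    constructor keeps its arguments out of the implicit arguments of the lemmas below. *)
Variant tends u l : Prop := Tends of u n @[n --> \oo] --> l.

Lemma tends_lim u l : tends u l -> limn u = l.
Proof. by move=> [h]; apply: cvg_lim h; exact: norm_hausdorff. Qed.

Lemma tends_unique u l l' : tends u l -> tends u l' -> l = l'.
Proof. by move=> /tends_lim <- /tends_lim. Qed.

Lemma tends_cst l : tends (fun=> l) l.
Proof. by split; exact: cvg_cst. Qed.

Lemma tendsD u v l l' : tends u l -> tends v l' -> tends (fun n => u n + v n) (l + l').
Proof. by move=> [h] [h']; split; apply: cvgD. Qed.

Lemma tendsN u l : tends u l -> tends (fun n => - u n) (- l).
Proof. by move=> [h]; split; apply: cvgN. Qed.

Lemma tendsB u v l l' : tends u l -> tends v l' -> tends (fun n => u n - v n) (l - l').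
Proof. by move=> h h'; apply: tendsD h (tendsN h'). Qed.

Lemma tendsM u v l l' : tends u l -> tends v l' -> tends (fun n => u n * v n) (l * l').
Proof. by move=> [h] [h']; split; apply: cvgM. Qed.

Lemma tendsV u l : l != 0 -> tends u l -> tends (fun n => (u n)^-1) l^-1.
Proof. by move=> h [h']; split; apply: cvgV. Qed.

Lemma tendsX u l k : tends u l -> tends (fun n => u n ^+ k) (l ^+ k).
Proof.
move=> h; elim: k => [|k IH]; first exact: tends_cst.
rewrite exprS; under [X in tends X]eq_fun do rewrite exprS.
exact: tendsM.
Qed.

Lemma tends_sum (I : Type) (r : seq I) (P : pred I) (F : I -> nat -> K) (l : I -> K) :
  (forall i, P i -> tends (F i) (l i)) ->
  tends (fun n => \sum_(i <- r | P i) F i n) (\sum_(i <- r | P i) l i).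
Proof. by move=> h; split; apply: cvg_big => [|i /h []//]; exact: add_continuous. Qed.

Lemma tends_prod (I : Type) (r : seq I) (P : pred I) (F : I -> nat -> K) (l : I -> K) :
  (forall i, P i -> tends (F i) (l i)) ->
  tends (fun n => \prod_(i <- r | P i) F i n) (\prod_(i <- r | P i) l i).
Proof. by move=> h; split; apply: cvg_big => [|i /h []//]; exact: mul_continuous. Qed.

Lemma tends_near u v l : (\forall n \near \oo, u n = v n) -> tends u l -> tends v l.
Proof. by move=> h [h']; split; apply: cvg_trans h'; apply: near_eq_cvg; apply: filterS h => n ->. Qed.

Lemma tends_neq0 u l : l != 0 -> tends u l -> \forall m \near \oo, u m != 0.
Proof. by move=> l0 [h]; apply: cvgr_neq0 h l0. Qed.

Lemma near_ltn (P : nat -> nat -> Prop) B :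
  (forall i, (i < B)%N -> \forall m \near \oo, P i m) ->
  \forall m \near \oo, forall i, (i < B)%N -> P i m.
Proof.
move=> h; have : \forall m \near \oo, forall i : 'I_B, P i m.
  by apply: filter_forall => i; apply: h.
by apply: filterS => m H i iB; exact: (H (Ordinal iB)).
Qed.

End Tends.

Section Modulus.
Local Open Scope classical_set_scope.
Variable R : realType.
Implicit Types (x y z : R[i]) (u : nat -> R[i]).

Local Notation nm := (@Normc.normc R).

(** The norm of [R[i]] takes its values in [R[i]]; estimates are made with the
    real-valued modulus [nm], for which the order is total. *)
Lemma normcR z : `|z| = (nm z)%:C.
Proof. by case: z. Qed.

Lemma nm_ge0 z : 0 <= nm z.
Proof. by rewrite -ler0c -normcR normr_ge0. Qed.

Lemma nmM x y : nm (x * y) = nm x * nm y.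
Proof. exact: Normc.normcM. Qed.

Lemma nmX x n : nm (x ^+ n) = nm x ^+ n.
Proof.
elim: n => [|n IH]; first by rewrite !expr0; exact: Normc.normc1.
by rewrite !exprS nmM IH.
Qed.

Lemma nmD x y : nm (x + y) <= nm x + nm y.
Proof. exact: le_normcD. Qed.

Lemma nmN x : nm (- x) = nm x.
Proof. exact: normcN. Qed.

Lemma nmB x y : nm (x - y) <= nm x + nm y.
Proof. by apply: le_trans (nmD _ _) _; rewrite nmN. Qed.

Lemma nm1 : nm 1 = 1. Proof. exact: Normc.normc1. Qed.

Lemma nm0 : nm 0 = 0. Proof. exact: Normc.normc0. Qed.

Lemma nmV x : nm x^-1 = (nm x)^-1.
Proof. exact: Normc.normcV. Qed.

Lemma nm_gt0 z : z != 0 -> 0 < nm z.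
Proof.
by move=> z0; rewrite lt_neqAle nm_ge0 andbT eq_sym; apply: contra z0 => /eqP /Normc.eq0_normc ->.
Qed.

Lemma nm_sum (I : Type) (r : seq I) (P : pred I) (F : I -> R[i]) :
  nm (\sum_(i <- r | P i) F i) <= \sum_(i <- r | P i) nm (F i).
Proof.
elim/big_rec2: _ => [|i y1 y2 _ h]; first by rewrite nm0.
by apply: le_trans (nmD _ _) _; rewrite lerD2l.
Qed.

Lemma nm_prod (I : Type) (r : seq I) (P : pred I) (F : I -> R[i]) :
  nm (\prod_(i <- r | P i) F i) = \prod_(i <- r | P i) nm (F i).
Proof. by apply: (big_morph nm nmM nm1). Qed.

Lemma nm_real (x : R) : nm x%:C = `|x|.
Proof. by rewrite /= expr0n addr0 sqrtr_sqr. Qed.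

Lemma nm_ge_Re z : `|complex.Re z| <= nm z.
Proof. by have := normc_ge_Re z; rewrite normcR lecR. Qed.

Lemma nm_ge_Im z : `|complex.Im z| <= nm z.
Proof.
case: z => a b /=; rewrite -sqrtr_sqr ler_sqrt ?addr_ge0 ?sqr_ge0 //.
by rewrite lerDr sqr_ge0.
Qed.

Lemma nm_le_ReIm z : nm z <= `|complex.Re z| + `|complex.Im z|.
Proof.
rewrite {1}[z]complexE; apply: le_trans (nmD _ _) _.
rewrite nmM !nm_real lerD2l; have -> : nm 'i%C = 1 by rewrite /= expr0n add0r expr1n sqrtr1.
by rewrite mul1r.
Qed.

Lemma tends_nmP u (l : R[i]) :
  tends u l <-> tends (fun n => nm (l - u n)) 0.
Proof.
split => -[h]; split.
  apply/cvgrPdist_lt => e e0.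
  have e0' : 0 < e%:C by rewrite -[0]/(0%:C) ltcR.
  have /cvgrPdist_lt/(_ _ e0') := h.
  by apply: filterS => n; rewrite normcR ltcR sub0r normrN ger0_norm // nm_ge0.
apply/cvgrPdist_lt => e e0.
have re : e = (complex.Re e)%:C by rewrite RRe_real // gtr0_real.
have e0' : 0 < complex.Re e by rewrite -ltcR -re.
have /cvgrPdist_lt/(_ _ e0') := h.
apply: filterS => n; rewrite sub0r normrN ger0_norm ?nm_ge0 // => k.
by rewrite re normcR ltcR.
Qed.

Lemma tends_le_nm u l (e : nat -> R) : (forall n, nm (l - u n) <= e n) ->
  tends e 0 -> tends u l.
Proof.
move=> h [e0]; apply/tends_nmP; split; apply: (squeeze_cvgr _ (cvg_cst 0) e0).
by near=> n; rewrite nm_ge0 h.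
Unshelve. all: by end_near.
Qed.

Lemma geometric_cvg0 (C rho : R) : 0 <= rho < 1 -> tends (fun n => C * rho ^+ n) 0.
Proof.
move=> /andP[r0 r1]; rewrite -[X in tends _ X](mulr0 C).
apply: tendsM; first exact: tends_cst.
by split; apply: cvg_expr; rewrite ger0_norm.
Qed.

Lemma geometric_sum_le (rho : R) n : 0 <= rho < 1 -> \sum_(0 <= j < n) rho ^+ j <= (1 - rho)^-1.
Proof.
move=> /andP[r0 r1]; have d : 0 < 1 - rho by rewrite subr_gt0.
rewrite -[leRHS]mul1r ler_pdivlMr //.
have -> : (\sum_(0 <= j < n) rho ^+ j) * (1 - rho) = 1 - rho ^+ n.
  elim: n => [|n IH]; first by rewrite big_geq // mul0r expr0 subrr.
  by rewrite big_nat_recr //= mulrDl IH exprS; ring.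
by rewrite gerBl exprn_ge0.
Qed.

Lemma real_geometric_cvg (v : nat -> R) (C rho : R) : 0 <= rho < 1 ->
  (forall n, `|v n.+1 - v n| <= C * rho ^+ n) -> exists l : R, tends v l.
Proof.
move=> rh h; set d := fun n => v n.+1 - v n.
have vE n : v n = v 0 + series d n.
  elim: n => [|n IH]; first by rewrite /series /= big_geq // addr0.
  by rewrite /series /= big_nat_recr //= addrA -IH /d; ring.
suff /cvg_ex [l hl] : cvgn (series d).
  have hl' : tends (series d) l by split.
  exists (v 0 + l); rewrite [X in tends X](_ : v = fun n => v 0 + series d n); last by apply/funext.
  exact: tendsD (tends_cst (v 0)) hl'.
apply: normed_cvg; apply: (@series_le_cvg _ _ (geometric C rho)).
- by move=> n; rewrite normr_ge0.
- by move=> n; rewrite /geometric /= (le_trans _ (h n)).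
- by move=> n; apply: h.
- by apply: is_cvg_geometric_series; case/andP: rh => r0 r1; rewrite ger0_norm.
Qed.

(** The error bound depends on [C] and [rho] only; this uniformity is what later gives
    the continuity of limits in parameters. *)
Lemma geometric_cvg u (C rho : R) : 0 <= rho < 1 ->
  (forall n, nm (u n.+1 - u n) <= C * rho ^+ n) ->
  exists l, forall n, nm (l - u n) <= C / (1 - rho) * rho ^+ n.
Proof.
move=> rh h.
have C0 : 0 <= C by apply: le_trans (nm_ge0 (u 1%N - u 0%N)) _; rewrite (le_trans (h 0)) ?expr0 ?mulr1.
have [a ha] : exists a, tends (fun n => complex.Re (u n)) a.
  apply: (@real_geometric_cvg _ C rho) => // n; rewrite -raddfB.
  exact: le_trans (nm_ge_Re _) (h n).
have [b hb] : exists b, tends (fun n => complex.Im (u n)) b.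
  apply: (@real_geometric_cvg _ C rho) => // n; rewrite -raddfB.
  exact: le_trans (nm_ge_Im _) (h n).
exists (a +i* b) => n.
have tele k : nm (u (n + k)%N - u n) <= C / (1 - rho) * rho ^+ n.
  have -> : u (n + k)%N - u n = \sum_(0 <= j < k) (u (n + j).+1 - u (n + j)%N).
    elim: k => [|k IH]; first by rewrite big_geq // addn0 subrr.
    by rewrite big_nat_recr //= -IH addnS; ring.
  apply: le_trans (nm_sum _ _ _) _.
  apply: (@le_trans _ _ (\sum_(0 <= j < k) C * rho ^+ n * rho ^+ j)).
    by apply: ler_sum => j _; rewrite -mulrA -exprD.
  rewrite -mulr_sumr [leRHS]mulrAC ler_wpM2l ?geometric_sum_le //.
  by rewrite mulr_ge0 // exprn_ge0 //; case/andP: rh.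
apply/ler_addgt0Pr => e e0.
have e2 : 0 < e / 2 by rewrite divr_gt0.
have [/cvgrPdist_lt/(_ _ e2) hA] := ha.
have [/cvgrPdist_lt/(_ _ e2) hB] := hb.
near \oo => m.
have mn : (n <= m)%N by near: m; exists n.
have hAm : `|a - complex.Re (u m)| < e / 2 by near: m.
have hBm : `|b - complex.Im (u m)| < e / 2 by near: m.
have -> : (a +i* b) - u n = ((a +i* b) - u m) + (u m - u n) by ring.
apply: le_trans (nmD _ _) _; rewrite addrC lerD //.
  by rewrite -(subnKC mn).
apply: le_trans (nm_le_ReIm _) _; rewrite !raddfB /=.
by rewrite [e]splitr; apply: lerD; apply: ltW.
Unshelve. all: by end_near.
Qed.

Section Product.
Variables (kappa rho : R) (f : nat -> R[i]).
Hypotheses (kappa0 : 0 <= kappa) (rho01 : 0 <= rho < 1).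
Hypothesis f_near1 : forall j, nm (f j - 1) <= kappa * rho ^+ j.

(** A bound of [prod (1 + kappa rho^j)], from [1 + t <= exp t]. *)
Definition prod_bound := expR (kappa / (1 - rho)).

Lemma nm_prod_le n : nm (\prod_(0 <= j < n) f j) <= prod_bound.
Proof.
apply: (@le_trans _ _ (expR (\sum_(0 <= j < n) kappa * rho ^+ j))); last first.
  by rewrite ler_expR -mulr_sumr ler_wpM2l // geometric_sum_le.
rewrite nm_prod; elim: n => [|n IH]; first by rewrite !big_geq // expR0.
rewrite !big_nat_recr //= expRD ler_pM //; first by rewrite prodr_ge0 // => i _; exact: nm_ge0.
  exact: nm_ge0.
have -> : f n = 1 + (f n - 1) by ring.
apply: le_trans (nmD _ _) _; rewrite nm1.
by apply: le_trans (expR_ge1Dx _); rewrite lerD2l.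
Qed.

Lemma prod_cvg : exists l, forall n,
  nm (l - \prod_(0 <= j < n) f j) <= prod_bound * kappa / (1 - rho) * rho ^+ n.
Proof.
apply: geometric_cvg => // n; rewrite big_nat_recr //=.
have -> : \prod_(0 <= i < n) f i * f n - \prod_(0 <= j < n) f j =
  (\prod_(0 <= i < n) f i) * (f n - 1) by ring.
rewrite nmM -mulrA ler_pM ?nm_ge0 //.
exact: nm_prod_le.
Qed.

(** A tail of the product stays above 1/2 in modulus, because a product of factors
    [1 - e_j] is at least [1 - sum e_j]; the remaining finite product is nonzero. *)
Lemma prod_lim_neq0 l : (forall j, f j != 0) ->
  tends (fun n => \prod_(0 <= j < n) f j) l -> l != 0.
Proof.
move=> fn0 hl; apply/eqP => l0; move: hl; rewrite l0 => /tends_nmP [].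
have [J hJ] : exists J, kappa / (1 - rho) * rho ^+ J <= 2^-1.
  have [/cvgrPdist_le/(_ 2^-1) [//|J _ hJ]] := geometric_cvg0 (kappa / (1 - rho)) rho01.
  exists J; have := hJ J (leqnn _); rewrite sub0r normrN; exact: le_trans (ler_norm _).
have /andP[r0 r1] := rho01.
have tail n : 1 - \sum_(0 <= j < n) kappa * rho ^+ (J + j) <=
    nm (\prod_(0 <= j < n) f (J + j)%N).
  elim: n => [|n IH]; first by rewrite !big_geq // nm1 subr0.
  rewrite !big_nat_recr //= nmM.
  set S := \sum_(0 <= i < n) _ in IH *; set P := nm _ in IH *.
  have f1 : 1 - kappa * rho ^+ (J + n) <= nm (f (J + n)%N).
    rewrite lerBlDr -nm1 -[X in nm X](subrK (f (J + n)%N)).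
    rewrite addrC; apply: le_trans (nmD _ _) _; rewrite lerD2l.
    by rewrite -nmN opprB.
  have e0 : 0 <= kappa * rho ^+ (J + n) by rewrite mulr_ge0 // exprn_ge0.
  have S0 : 0 <= S by rewrite sumr_ge0 // => i _; rewrite mulr_ge0 // exprn_ge0.
  have P0 : 0 <= P := nm_ge0 _.
  have F0 := nm_ge0 (f (J + n)%N).
  have : S + kappa * rho ^+ (J + n) <= 1.
    have -> : S + kappa * rho ^+ (J + n) = kappa * rho ^+ J * \sum_(0 <= j < n.+1) rho ^+ j.
      rewrite mulr_sumr big_nat_recr //= -mulrA -exprD; congr (_ + _).
      by apply: eq_bigr => j _; rewrite exprD mulrA.
    apply: le_trans (_ : kappa * rho ^+ J * (1 - rho)^-1 <= _).
      by rewrite ler_wpM2l ?geometric_sum_le // mulr_ge0 // exprn_ge0.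
    by rewrite mulrAC (le_trans hJ) //; lra.
(* the inequality (1 - S) (1 - e) >= 1 - (S + e), with 1 - S nonnegative *)
  move: (nm _) (kappa * _) S P e0 S0 P0 F0 f1 IH => F e S0 P0; nra.
have half n : 2^-1 <= nm (\prod_(0 <= j < n) f (J + j)%N).
  apply: le_trans (tail n).
  have : \sum_(0 <= j < n) kappa * rho ^+ (J + j) <= 2^-1.
    rewrite (eq_bigr (fun j => kappa * rho ^+ J * rho ^+ j)); last first.
      by move=> j _; rewrite exprD mulrA.
    rewrite -mulr_sumr; apply: le_trans hJ; rewrite [leRHS]mulrAC ler_wpM2l //.
      by rewrite mulr_ge0 // exprn_ge0.
    exact: geometric_sum_le.
  lra.
set c := nm (\prod_(0 <= j < J) f j).
have c0 : 0 < c by rewrite nm_gt0 // prodf_seq_neq0; apply/allP => j _; rewrite fn0.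
have c2 : 0 < c / 2 by rewrite divr_gt0.
move=> /cvgrPdist_lt/(_ _ c2) [M _ hM].
have := hM (J + M)%N (leq_addl _ _); rewrite /= !sub0r normrN nmN ger0_norm ?nm_ge0 //.
rewrite (@big_cat_nat _ _ _ J) //= ?leq_addr // nmM -/c.
rewrite -{1}[J]add0n big_addn addKn.
under eq_bigr do rewrite addnC.
by rewrite ltNge ler_wpM2l // ltW.
Qed.

End Product.
End Modulus.

(** * The theta function: convergence, inversion, continuity, zeros *)
Section Theta.
Local Open Scope classical_set_scope.
Variables (R : realType) (p : R[i]).
Hypothesis p_lt1 : `|p| < 1.
Implicit Types (z : R[i]) (u : nat -> R[i]).

Local Notation nm := (@ComplexField.Normc.normc R).
Local Notation rho := (nm p).

Definition theta_factor z j : R[i] := (1 - z * p ^+ j) * (1 - p ^+ j.+1 / z).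

Lemma theta_lim z l :
  tends (fun n => \prod_(0 <= j < n) theta_factor z j) l -> theta z p = l.
Proof. exact: tends_lim. Qed.

Lemma nm_p01 : 0 <= rho < 1.
Proof. by rewrite nm_ge0 /= -ltcR -normcR. Qed.

(** Any upper bound [kappa] of [|z| + 1/|z| + 1] is allowed, so that one constant
    serves for all [z] in a neighbourhood. *)
Lemma theta_factor_near1 z kappa j : z != 0 -> nm z + (nm z)^-1 + 1 <= kappa ->
  nm (theta_factor z j - 1) <= kappa * rho ^+ j.
Proof.
move=> z0 hk; have /andP[r0 r1] := nm_p01.
have -> : theta_factor z j - 1 = - (z * p ^+ j) - z^-1 * p ^+ j * p + p ^+ j * p ^+ j.+1.
  by rewrite /theta_factor exprS; field.
apply: le_trans (nmD _ _) _; apply: (@le_trans _ _ (nm z * rho ^+ j + (nm z)^-1 * rho ^+ j + rho ^+ j)); last first.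
  rewrite -[X in _ + _ + X]mul1r -!mulrDl ler_wpM2r // exprn_ge0 //.
have rj := exprn_ge0 j r0.
apply: lerD.
  apply: le_trans (nmB _ _) _; rewrite nmN !nmM nmX nmV lerD2l -[leRHS]mulr1.
  by rewrite ler_wpM2l // ?mulr_ge0 // ?invr_ge0 ?nm_ge0 // ltW.
rewrite nmM !nmX -[leRHS]mulr1 ler_wpM2l // exprn_ile1 //; exact: ltW.
Qed.

Lemma kappa_ge0 z : z != 0 -> 0 <= nm z + (nm z)^-1 + 1.
Proof. by move=> z0; rewrite !addr_ge0 // ?invr_ge0 ?nm_ge0. Qed.

Lemma tends_tail u l (C : R) : (forall n, nm (l - u n) <= C * rho ^+ n) -> tends u l.
Proof. by move=> h; apply: (tends_le_nm h); apply: geometric_cvg0; exact: nm_p01. Qed.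

Lemma theta_tail z kappa n : z != 0 -> nm z + (nm z)^-1 + 1 <= kappa ->
  nm (theta z p - \prod_(0 <= j < n) theta_factor z j) <=
    prod_bound kappa rho * kappa / (1 - rho) * rho ^+ n.
Proof.
move=> z0 hk; have k0 : 0 <= kappa := le_trans (kappa_ge0 z0) hk.
have [l hl] := prod_cvg k0 nm_p01 (fun j => theta_factor_near1 j z0 hk).
by rewrite (theta_lim (tends_tail hl)).
Qed.

Lemma theta_tends z : z != 0 ->
  tends (fun n => \prod_(0 <= j < n) theta_factor z j) (theta z p).
Proof. by move=> z0; apply: tends_tail => n; exact: theta_tail (lexx _). Qed.

Lemma theta1 : theta 1 p = 0.
Proof.
apply: tends_unique (theta_tends (oner_neq0 _)) _.
apply: tends_near (tends_cst 0); exists 1%N => // -[|n] // _.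
by rewrite big_nat_recl // /theta_factor expr0 mulr1 subrr !mul0r.
Qed.

(** The finite products for [1/z] and for [z] share all factors but two each. *)
Lemma thetaV z : z != 0 -> theta z^-1 p = - theta z p / z.
Proof.
move=> z0; have zV0 : z^-1 != 0 by rewrite invr_eq0.
have E n : (\prod_(0 <= j < n) theta_factor z^-1 j) * (1 - p ^+ n / z) =
    - ((\prod_(0 <= j < n) theta_factor z j) / z) * (1 - z * p ^+ n).
  elim: n => [|n IH]; first by rewrite !big_geq // expr0; field.
  rewrite !big_nat_recr //=.
  move: (\prod_(0 <= j < n) _) (\prod_(0 <= j < n) _) IH => Q P IH.
  rewrite /theta_factor invrK exprS.
  transitivity ((P * (1 - p ^+ n / z)) * ((1 - p * p ^+ n * z) * (1 - p * p ^+ n / z))).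
    by ring.
  by rewrite IH; ring.
have pn0 : tends (fun n => p ^+ n) 0.
  by apply: (@tends_tail _ _ 1) => n; rewrite sub0r nmN nmX mul1r.
have t1 c : tends (fun n => 1 - c * p ^+ n) 1.
  rewrite [X in tends _ X](_ : _ = 1 - c * 0); last by rewrite mulr0 subr0.
  by apply: tendsD (tends_cst _) (tendsN (tendsM (tends_cst _) pn0)).
have A := tendsM (theta_tends zV0) (t1 z^-1).
have B := tendsM (tendsN (tendsM (theta_tends z0) (tends_cst z^-1))) (t1 z).
rewrite !mulr1 in A B; rewrite mulNr; apply: tends_unique A _.
by apply: tends_near B; apply: nearW => n; rewrite -E [z^-1 * _]mulrC.
Qed.

(** The finite products converge uniformly near [z], by [theta_tail] with the
    same [kappa] for all points at distance less than [min 1 (|z|/2)]. *)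
Lemma theta_continuous u z : z != 0 -> tends u z ->
  tends (fun n => theta (u n) p) (theta z p).
Proof.
move=> z0 hu; have nz := nm_gt0 z0.
set kappa := (nm z + 1) + 2 / nm z + 1.
have kz : nm z + (nm z)^-1 + 1 <= kappa.
  rewrite /kappa lerD2r lerD //; first by rewrite lerDl.
  by rewrite -[leLHS]mul1r ler_wpM2r ?invr_ge0 ?nm_ge0 // ler1n.
have k0 : 0 <= kappa := le_trans (kappa_ge0 z0) kz.
set C := prod_bound kappa rho * kappa / (1 - rho).
apply/tends_nmP; split; apply/cvgrPdist_lt => e e0.
have e3 : 0 < e / 3 by rewrite divr_gt0.
have [/cvgrPdist_lt/(_ _ e3) [m _ hm]] := geometric_cvg0 C nm_p01.
have {hm} := hm m (leqnn m); rewrite /= sub0r normrN => hm.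
have hC : C * rho ^+ m < e / 3 by apply: le_lt_trans (ler_norm _) hm.
have tu : tends (fun n => \prod_(0 <= j < m) theta_factor (u n) j)
               (\prod_(0 <= j < m) theta_factor z j).
  apply: tends_prod => j _; apply: tendsM.
    apply: tendsD (tends_cst _) (tendsN (tendsM hu (tends_cst _))).
  apply: tendsD (tends_cst _) (tendsN (tendsM (tends_cst _) (tendsV z0 hu))).
have [/cvgrPdist_lt/(_ _ e3) htu] := (tends_nmP _ _).1 tu.
have z2 : 0 < Num.min 1 (nm z / 2) by rewrite lt_min ltr01 divr_gt0.
have [/cvgrPdist_lt/(_ _ z2) hu2] := (tends_nmP _ _).1 hu.
near=> n.
have A : nm (z - u n) < Num.min 1 (nm z / 2).
  have : `|0 - nm (z - u n)| < Num.min 1 (nm z / 2) by near: n.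
  by rewrite sub0r normrN ger0_norm // nm_ge0.
have B : nm (\prod_(0 <= j < m) theta_factor z j - \prod_(0 <= j < m) theta_factor (u n) j) < e / 3.
  have : `|0 - nm (\prod_(0 <= j < m) theta_factor z j - \prod_(0 <= j < m) theta_factor (u n) j)| < e / 3 by near: n.
  by rewrite sub0r normrN ger0_norm // nm_ge0.
move: A; rewrite lt_min => /andP[A1 A2].
have un1 : nm (u n) <= nm z + 1.
  have -> : u n = z - (z - u n) by ring.
  by apply: le_trans (nmB _ _) _; rewrite lerD2l ltW.
have un2 : nm z / 2 <= nm (u n).
  have : nm z <= nm (z - u n) + nm (u n) by rewrite -{1}[z](subrK (u n)) nmD.
  move: A2; lra.
have unp : 0 < nm (u n) by apply: lt_le_trans un2; rewrite divr_gt0.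
have un0 : u n != 0 by apply: contraTneq unp => ->; rewrite nm0 ltxx.
have ku : nm (u n) + (nm (u n))^-1 + 1 <= kappa.
  rewrite /kappa lerD2r lerD // -[2 / _]invrK invf_div lef_pV2 ?posrE // divr_gt0 //.
have T1 := theta_tail m z0 kz.
have T2 := theta_tail m un0 ku.
rewrite -/C in T1 T2.
rewrite sub0r normrN ger0_norm ?nm_ge0 //.
set a := theta z p in T1 *; set b := theta (u n) p in T2 *.
set a' := \prod_(_ <= _ < _) _ in T1 B; set b' := \prod_(_ <= _ < _) _ in T2 B.
have -> : a - b = (a - a') + ((a' - b') - (b - b')) by ring.
apply: le_lt_trans (nmD _ _) _.
apply: (@le_lt_trans _ _ (nm (a - a') + (nm (a' - b') + nm (b - b')))).
  by rewrite lerD2l nmB.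
move: B T1 T2 hC; lra.
Unshelve. all: by end_near.
Qed.

(** A convergent product vanishes only if one of its factors does. *)
Lemma theta_eq0P z : z != 0 ->
  reflect (exists j, (z * p ^+ j == 1) || (z == p ^+ j.+1)) (theta z p == 0).
Proof.
move=> z0; apply: (iffP idP) => [/eqP tz|[j hj]].
  apply: contrapT => hn.
  have f0 j : theta_factor z j != 0.
    apply/negP; rewrite mulf_eq0 !subr_eq0 => h; apply: hn; exists j.
    case/orP: h => /eqP h; first by rewrite -h eqxx.
    by apply/orP; right; apply/eqP; apply: (mulIf (x := z^-1)); rewrite ?invr_eq0 // divff.
  have := prod_lim_neq0 (kappa_ge0 z0) nm_p01 (fun j => theta_factor_near1 j z0 (lexx _)) f0 (theta_tends z0).
  by rewrite tz eqxx.
apply/eqP; apply: tends_unique (theta_tends z0) _.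
apply: tends_near (tends_cst 0); exists j.+1 => // n /= jn.
rewrite (@big_cat_nat _ _ _ j.+1) //= big_nat_recr //=.
suff -> : theta_factor z j = 0 by rewrite mulr0 mul0r.
rewrite /theta_factor; case/orP: hj => /eqP h; first by rewrite h subrr mul0r.
by rewrite -h divff // subrr mulr0.
Qed.

(** The zeros of theta are the integer powers of [p], which form a group; if [p = 0]
    the only zero is 1. *)
Lemma theta_div_eq0 x y : x != 0 -> y != 0 ->
  theta x p = 0 -> theta y p = 0 -> theta (x / y) p = 0.
Proof.
have [p0|p0] := eqVneq p 0.
  have one z : z != 0 -> theta z p = 0 -> z = 1.
    move=> z0 /eqP /(theta_eq0P z0) [j]; rewrite p0 exprS mul0r (negPf z0) orbF.
    case: j => [|j]; first by rewrite expr0 mulr1 => /eqP.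
    by rewrite exprS mul0r mulr0 eq_sym oner_eq0.
  by move=> x0 y0 /one -> // /one -> //; rewrite divr1 theta1.
have int_pow z : z != 0 -> theta z p = 0 -> exists k : int, z = p ^ k.
  move=> z0 /eqP /(theta_eq0P z0) [j /orP[/eqP h|/eqP ->]]; last by exists j.+1%:Z.
  exists (- j%:Z); rewrite -exprnN; apply: (mulIf (x := p ^+ j)); first by rewrite expf_neq0.
  by rewrite h mulVf // expf_neq0.
have pow_int (k : int) : theta (p ^ k) p = 0.
  have pk0 : p ^ k != 0 by rewrite expfz_eq0 negb_and p0 orbT.
  apply/eqP; apply/(theta_eq0P pk0).
  case: k pk0 => [[|k]|k] pk0; first by exists 0; rewrite expr0 mulr1 expr0z eqxx.
    by exists k; rewrite -exprnP eqxx orbT.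
  exists k.+1; rewrite NegzE -exprnN mulVf ?eqxx // expf_neq0 //.
move=> x0 y0 /int_pow [//|k ->] /int_pow [//|l ->].
by rewrite -(pow_int (k - l)) expfzDr // -invr_expz.
Qed.

End Theta.

(** * The finite Jacobi triple product *)
(** The integers of absolute value at most [L], the range of the symmetric partial
    sums of a bilateral series. *)
Fixpoint zrange (L : nat) : seq int :=
  if L is L'.+1 then [:: L%:Z, - L%:Z & zrange L'] else [:: 0].

Lemma mem_zrange L (n : int) : (n \in zrange L) = (`|n| <= L)%N.
Proof. by elim: L => [|L IH] /=; rewrite !inE ?IH; lia. Qed.

Lemma zrange_uniq L : uniq (zrange L).
Proof. by elim: L => [|L IH] //=; rewrite IH !inE !mem_zrange; lia. Qed.

Lemma big_zrangeS (V : nmodType) L (F : int -> V) :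
  \sum_(n <- zrange L.+1) F n = F L.+1%:Z + (F (- L.+1%:Z) + \sum_(n <- zrange L) F n).
Proof. by rewrite /= !big_cons. Qed.

Lemma big_zrange (V : nmodType) L (F : int -> V) :
  \sum_(0 <= k < (2 * L).+1) F (k%:Z - L%:Z) = \sum_(n <- zrange L) F n.
Proof.
rewrite -(big_map (fun k : nat => k%:Z - L%:Z) xpredT F); apply: perm_big.
apply: uniq_perm; rewrite ?zrange_uniq ?map_inj_uniq ?iota_uniq //.
  by move=> i j; lia.
move=> n; rewrite mem_zrange; apply/mapP/idP => [[k]|hn].
  by rewrite mem_index_iota => hk ->; lia.
exists (absz (n + L%:Z)); first by rewrite mem_index_iota; lia.
by lia.
Qed.

Section GaussBinomial.
Variables (K : fieldType) (p : K).

(** The Gaussian binomial coefficient in base [p], defined by Pascal's rule so that no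
    division is needed. *)
Fixpoint gauss_binom (N k : nat) : K :=
  match N, k with
  | _, 0 => 1
  | 0, _.+1 => 0
  | N'.+1, k'.+1 => gauss_binom N' k + p ^+ (N' - k') * gauss_binom N' k'
  end.

Lemma gauss_binom0 N : gauss_binom N 0 = 1. Proof. by case: N. Qed.

Lemma gauss_binom_small N k : (N < k)%N -> gauss_binom N k = 0.
Proof.
elim: N k => [|N IH] [|k] //= h; rewrite !IH ?mulr0 ?addr0 //; exact: ltnW.
Qed.

(** The finite product [(p; p)_N]. *)
Definition euler_prod N := \prod_(0 <= j < N) (1 - p ^+ j.+1).

Lemma gauss_binomE N k : (k <= N)%N ->
  gauss_binom N k * (euler_prod k * euler_prod (N - k)) = euler_prod N.
Proof.
elim: N k => [|N IH] [|k] //=.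
- by move=> _; rewrite /euler_prod big_geq // !mulr1.
- by move=> _; rewrite /euler_prod big_geq // !mul1r.
move=> h; rewrite subSS.
have eS M : euler_prod M.+1 = euler_prod M * (1 - p ^+ M.+1) by rewrite /euler_prod big_nat_recr.
rewrite mulrDl [X in _ + X = _](_ : _ = p ^+ (N - k) * (1 - p ^+ k.+1) * euler_prod N); last first.
  by rewrite -(IH k) // eS; ring.
rewrite [X in X + _ = _](_ : _ = (1 - p ^+ (N - k)) * euler_prod N).
  rewrite -mulrDl eS mulrC; congr (_ * _).
  have -> : N.+1 = (k.+1 + (N - k))%N by lia.
  by rewrite exprD; ring.
move: h; rewrite ltnS leq_eqVlt => /orP[/eqP ->|h].
  by rewrite gauss_binom_small // subnn expr0 subrr !mul0r.
by rewrite -(IH k.+1) // (_ : (N - k = (N - k.+1).+1)%N) ?eS; [ring|lia].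
Qed.

Lemma gauss_binomial_theorem N x :
  \prod_(0 <= j < N) (1 + x * p ^+ j) =
  \sum_(0 <= k < N.+1) gauss_binom N k * p ^+ 'C(k, 2) * x ^+ k.
Proof.
elim: N => [|N IH]; first by rewrite big_geq // big_nat1 !mulr1.
rewrite big_nat_recr //= IH mulrDr mulr1 [RHS]big_nat_recl //= !expr0 !mulr1.
under [in RHS]eq_bigr do rewrite mulrDl mulrDl.
rewrite big_split addrA /=; congr (_ + _).
  rewrite big_nat_recl //= gauss_binom0 !expr0 !mulr1; congr (_ + _).
  by rewrite [RHS]big_nat_recr //= gauss_binom_small // !mul0r addr0.
rewrite mulr_suml; apply: eq_big_nat => k /andP[_ hk].
have -> : p ^+ N = p ^+ (N - k) * p ^+ k by rewrite -exprD subnK.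
by rewrite binS bin1 exprD exprS; ring.
Qed.

End GaussBinomial.

Section TripleProduct.
Variables (K : fieldType) (r : K).
Hypothesis r0 : r != 0.

Definition triple_prod w m :=
  \prod_(0 <= j < m) ((1 + w * r ^+ (2 * j).+1) * (1 + r ^+ (2 * j).+1 / w)).

(** The general term of the theta series in the variable [w], with nome [r]. *)
Definition gauss_term w (n : int) := r ^ (n * n) * w ^ n.

(** This is the Gaussian binomial theorem for [2 m] factors at [x = w r^(1 - 2 m)]:
    the first [m] factors have negative powers of [r], and pulling these powers out
    turns them into the factors [1 + r^(2 j + 1) / w]. *)
Lemma finite_triple_product w m : w != 0 ->
  triple_prod w m =
  \sum_(n <- zrange m) gauss_binom (r ^+ 2) (2 * m) (absz (n + m%:Z)) * gauss_term w n.
Proof.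
move=> w0.
have wr (k : int) : r ^ k != 0 by rewrite expfz_eq0 negb_and r0 orbT.
have E : \prod_(0 <= j < 2 * m) (1 + w * r ^ (1 - 2 * m%:Z) * (r ^+ 2) ^+ j) =
     triple_prod w m * (w ^+ m * r ^ (- (m%:Z * m%:Z))).
  rewrite (@big_cat_nat _ _ _ m) //=; last by lia.
  have -> (F : nat -> K) : \prod_(m <= j < 2 * m) F j = \prod_(0 <= j < m) F (j + m)%N.
    by rewrite -{1}[m]add0n big_addn (_ : (2 * m - m = m)%N) //; lia.
  rewrite mulrC [X in _ * X = _]big_nat_rev /= add0n.
  rewrite /triple_prod big_split /= -!mulrA; congr (_ * _).
    apply: eq_big_nat => j _; congr (1 + _); rewrite -mulrA; congr (_ * _).
    by rewrite -exprM !exprnP -expfzDr //; congr (_ ^ _); lia.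
  have -> : w ^+ m * r ^ (- (m%:Z * m%:Z)) = \prod_(0 <= j < m) (w * r ^ (- (2 * j).+1%:Z)).
    elim: (m) => [|i IH]; first by rewrite big_geq // expr0 mul1r.
    rewrite big_nat_recr //= -IH exprSr mulrACA; congr (_ * _).
    by rewrite -expfzDr //; congr (_ ^ _); lia.
  rewrite -big_split /=; apply: eq_big_nat => j hj.
  rewrite [RHS]mulrDl mul1r [LHS]addrC; congr (_ + _).
    rewrite -mulrA; congr (_ * _).
    by rewrite -exprM !exprnP -expfzDr //; congr (_ ^ _); lia.
  rewrite [X in _ = X](_ : _ = (w^-1 * w) * (r ^+ (2 * j).+1 * r ^ (- (2 * j).+1%:Z))); last by ring.
  by rewrite mulVf // mul1r exprnP -expfzDr // subrr.
have nz : w ^+ m * r ^ (- (m%:Z * m%:Z)) != 0 by rewrite mulf_neq0 // expf_neq0.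
apply: (mulIf nz); rewrite -E gauss_binomial_theorem -big_zrange mulr_suml.
apply: eq_big_nat => k _.
rewrite subrK /= -!mulrA; congr (_ * _).
rewrite /gauss_term -[_ ^+ 2 ^+ _]exprM [(w * _) ^+ k]exprMn [_ * (r ^ _) ^+ k]mulrC.
have -> : (r ^ (1 - 2 * m%:Z)) ^+ k = r ^ ((1 - 2 * m%:Z) * k%:Z) by rewrite [LHS]exprnP exprz_exp.
have -> : w ^+ k = w ^ (k%:Z - m%:Z) * w ^+ m.
  by rewrite [w ^+ m]exprnP -expfzDr // subrK.
rewrite [LHS](_ : _ = (r ^ (2 * 'C(k, 2))%N%:Z * r ^ ((1 - 2 * m%:Z) * k%:Z)) * (w ^ (k%:Z - m%:Z) * w ^+ m)); last first.
  by rewrite -exprnP; ring.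
rewrite [RHS](_ : _ = (r ^ ((k%:Z - m%:Z) * (k%:Z - m%:Z)) * r ^ (- (m%:Z * m%:Z))) * (w ^ (k%:Z - m%:Z) * w ^+ m)); last by ring.
rewrite -!expfzDr //; congr (_ ^ _ * _).
have : (2 * 'C(k, 2) = k * k.-1)%N by rewrite bin2 mul2n -[RHS]odd_double_half -[odd _]negbK oddM; case: k => // k; rewrite /= andNb.
by move=> ->; case: k => [|k] /=; lia.
Qed.

End TripleProduct.

(** * The triple product expansion of theta *)
Section GaussSums.
Local Open Scope classical_set_scope.
Variable R : realType.

(** Gaussian decay: [(rho^k (2 v))^k] is at most 1 as soon as [rho^k (2 v) <= 1]. *)
Lemma gauss_term_le (rho v : R) : 0 < rho < 1 -> 0 < v ->
  exists2 M, 0 <= M & forall k : nat, rho ^+ (k * k) * v ^+ k <= M * 2^-1 ^+ k.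
Proof.
move=> /andP[r0 r1] v0.
have [N hN] : exists N, (2 * v) * rho ^+ N <= 1.
  have [] := @geometric_cvg0 R (2 * v) rho; first by rewrite r1 ltW.
  move=> /cvgrPdist_le/(_ 1 ltr01) [N _ hN]; exists N.
  by have := hN N (leqnn _); rewrite /= sub0r normrN; apply: le_trans; exact: ler_norm.
exists (Num.max 1 (2 * v) ^+ N); first by rewrite exprn_ge0 // le_max ler01.
move=> k; rewrite -ler_pdivrMr ?exprn_gt0 ?invr_gt0 // -exprVn invrK.
have -> : rho ^+ (k * k) * v ^+ k * 2 ^+ k = ((2 * v) * rho ^+ k) ^+ k.
  by rewrite !exprMn exprM; ring.
have M1 : 1 <= Num.max 1 (2 * v) by rewrite le_max lexx.
have v2 : 0 <= 2 * v by rewrite mulr_ge0 // ltW.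
have [Nk|kN] := leqP N k.
  apply: (@le_trans _ _ 1); last exact: exprn_ege1.
  apply: exprn_ile1; first by rewrite mulr_ge0 // exprn_ge0 // ltW.
  apply: le_trans hN; rewrite ler_wpM2l // ler_wiXn2l // ltW //.
apply: (@le_trans _ _ (Num.max 1 (2 * v) ^+ k)); last by rewrite ler_weXn2l // ltnW.
apply: lerXn2r; rewrite ?nnegrE; first by rewrite mulr_ge0 // exprn_ge0 // ltW.
  by rewrite le_max ler01.
apply: (@le_trans _ _ (2 * v)); last by rewrite le_max lexx orbT.
by rewrite -[leRHS]mulr1 ler_wpM2l // exprn_ile1 // ltW.
Qed.

Lemma gauss_sum_cvg (rho v : R) : 0 < rho < 1 -> 0 < v ->
  exists l, tends (fun L => \sum_(n <- zrange L) gauss_term rho v n) l.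
Proof.
move=> rh v0; have vV : 0 < v^-1 by rewrite invr_gt0.
have [M M0 hM] := gauss_term_le rh v0; have [M' M0' hM'] := gauss_term_le rh vV.
have /andP[r0 r1] := rh.
have pos n : 0 <= gauss_term rho v n by rewrite mulr_ge0 // exprz_ge0 // ltW.
apply: (@real_geometric_cvg _ _ (M + M') 2^-1); first by lra.
move=> L; rewrite big_zrangeS addrA addrK ger0_norm ?addr_ge0 //.
apply: (@le_trans _ _ ((M + M') * 2^-1 ^+ L.+1)); last first.
  by rewrite ler_wpM2l ?addr_ge0 // ler_wiXn2l //; lra.
rewrite mulrDl; apply: lerD; first exact: hM.
by rewrite /gauss_term mulrNN -exprnN -exprVn; exact: hM'.
Qed.
End GaussSums.

Section TripleProductLimit.
Local Open Scope classical_set_scope.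
Variables (R : realType) (p r : R[i]).
Hypotheses (p_lt1 : `|p| < 1) (r2 : r ^+ 2 = p) (r0 : r != 0).
Local Notation nm := (@ComplexField.Normc.normc R).

Lemma nm_r01 : 0 < nm r < 1.
Proof.
rewrite nm_gt0 //=; have /andP[_] := nm_p01 p_lt1; rewrite -r2 nmX.
by rewrite expr_lt1 // nm_ge0.
Qed.

Lemma nm_exprz z (n : int) : nm (z ^ n) = nm z ^ n.
Proof.
by case: n => n; rewrite ?NegzE -?exprnN -?exprnP ?nmV nmX.
Qed.

Lemma nm_gauss_term w n : nm (gauss_term r w n) = gauss_term (nm r) (nm w) n.
Proof. by rewrite /gauss_term nmM !nm_exprz. Qed.

Lemma one_sub_pX_neq0 j : 1 - p ^+ j.+1 != 0.
Proof.
have /andP[_ r1] := nm_p01 p_lt1.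
rewrite subr_eq0; apply/eqP => h; have : nm (p ^+ j.+1) < 1 by rewrite nmX exprn_ilt1 ?nm_ge0.
by rewrite -h nm1 ltxx.
Qed.

Lemma euler_prod_neq0 N : euler_prod p N != 0.
Proof. by rewrite prodf_seq_neq0; apply/allP => j _; rewrite one_sub_pX_neq0. Qed.

Lemma euler_factor_near1 j : nm (1 - p ^+ j.+1 - 1) <= 1 * nm p ^+ j.
Proof.
have /andP[q0 q1] := nm_p01 p_lt1.
rewrite (_ : 1 - p ^+ j.+1 - 1 = - p ^+ j.+1); last by ring.
by rewrite nmN nmX mul1r ler_wiXn2l // ltW.
Qed.

Lemma euler_prod_cvg : exists2 Q, Q != 0 &
  exists C, forall N, nm (Q - euler_prod p N) <= C * nm p ^+ N.
Proof.
have [Q hQ] := prod_cvg ler01 (nm_p01 p_lt1) euler_factor_near1.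
exists Q; last by eexists; exact: hQ.
apply: (prod_lim_neq0 ler01 (nm_p01 p_lt1) euler_factor_near1 one_sub_pX_neq0).
exact: tends_tail hQ.
Qed.

Lemma euler_prod_bounded : exists B, forall N, nm (euler_prod p N) <= B /\ nm (euler_prod p N)^-1 <= B.
Proof.
have h := nm_p01 p_lt1; have /andP[q0 q1] := h.
have d0 : 0 <= (1 - nm p)^-1 by rewrite invr_ge0 subr_ge0 ltW.
exists (Num.max (prod_bound 1 (nm p)) (prod_bound (1 - nm p)^-1 (nm p))) => N; split; rewrite le_max; apply/orP.
  by left; apply: nm_prod_le => //; exact: euler_factor_near1.
right; rewrite /euler_prod -prodfV; apply: nm_prod_le => // j.
have f0 := one_sub_pX_neq0 j.
rewrite (_ : (1 - p ^+ j.+1)^-1 - 1 = p ^+ j.+1 / (1 - p ^+ j.+1)); last by field.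
rewrite nmM nmV nmX mulrC; apply: ler_pM; rewrite ?invr_ge0 ?nm_ge0 ?exprn_ge0 //; last first.
  by rewrite ler_wiXn2l // ltW.
rewrite lef_pV2 ?posrE ?nm_gt0 ?subr_gt0 // lerBlDr.
apply: (@le_trans _ _ (nm (1 - p ^+ j.+1) + nm (p ^+ j.+1))).
  by rewrite -nm1 -{1}[1](subrK (p ^+ j.+1)) nmD.
by rewrite lerD2l nmX exprS ler_piMr // exprn_ile1 // ltW.
Qed.

(** The coefficient of [w^n] in the finite triple product is
    [(p)_(2m) / ((p)_(m+n) (p)_(m-n))], and all three indices are at least [m - |n|]. *)
Lemma gauss_binom_near (Q : R[i]) (C : R) : Q != 0 -> (forall N, nm (Q - euler_prod p N) <= C * nm p ^+ N) ->
  exists2 D, 0 <= D & forall m (n : int), (absz n <= m)%N ->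
    nm (1 - Q * gauss_binom p (2 * m) (absz (n + m%:Z))) <= D * nm p ^+ (m - absz n).
Proof.
move=> Q0 hQ; have [B hB] := euler_prod_bounded; have /andP[q0 q1] := nm_p01 p_lt1.
have B0 : 0 <= B by apply: le_trans (nm_ge0 _) (hB 0).1.
have C0 : 0 <= C by have := hQ 0%N; rewrite expr0 mulr1; apply: le_trans; exact: nm_ge0.
exists ((B * C + nm Q * (C + C)) * (B * B)).
  by rewrite !mulr_ge0 // !addr_ge0 // !mulr_ge0 ?nm_ge0 // addr_ge0.
move=> m n nm'; set k := absz _; set a := (m - absz n)%N.
have k2m : (k <= 2 * m)%N by lia.
have ak : (a <= k)%N by lia. have ak' : (a <= 2 * m - k)%N by lia.
have am : (a <= 2 * m)%N by lia.
have mono i : (a <= i)%N -> nm p ^+ i <= nm p ^+ a by move=> h; rewrite ler_wiXn2l // ltW.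
have e1 := euler_prod_neq0 k; have e2 := euler_prod_neq0 (2 * m - k).
have -> : 1 - Q * gauss_binom p (2 * m) k =
  (euler_prod p k * (- (Q - euler_prod p (2 * m - k))) + Q * ((Q - euler_prod p (2 * m)) - (Q - euler_prod p k))) *
  ((euler_prod p k)^-1 * (euler_prod p (2 * m - k))^-1).
  rewrite -(gauss_binomE p k2m); field; by rewrite e1 e2.
rewrite nmM [leRHS]mulrAC; apply: ler_pM; rewrite ?nm_ge0 //; last first.
  by rewrite nmM; apply: ler_pM; rewrite ?nm_ge0 //; exact: (hB _).2.
have near i : (a <= i)%N -> nm (Q - euler_prod p i) <= C * nm p ^+ a.
  by move=> h; apply: le_trans (hQ i) _; rewrite ler_wpM2l // mono.
apply: le_trans (nmD _ _) _; rewrite mulrDl; apply: lerD.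
  by rewrite nmM -mulrA nmN; apply: ler_pM; rewrite ?nm_ge0 ?(hB _).1 ?near.
rewrite nmM -mulrA ler_wpM2l ?nm_ge0 //; apply: le_trans (nmB _ _) _.
by rewrite mulrDl lerD ?near.
Qed.

Lemma theta_triple_prod w m : w != 0 ->
  triple_prod r w m = \prod_(0 <= j < m) theta_factor p (- (r * w)) j.
Proof.
move=> w0; apply: eq_big_nat => j _; rewrite /theta_factor -r2 -!exprM.
congr (_ * _); first by rewrite exprS; ring.
rewrite (_ : (2 * j.+1 = (2 * j).+2)%N); last by lia.
by rewrite [in RHS]exprS; field; rewrite w0.
Qed.

(** The limit of [finite_triple_product].  The error in the coefficient of [w^n] is
    [O(p^(m - |n|))], and [p^(-|n|)] is absorbed by the Gaussian weight at the cost of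
    replacing [|w|] by [|w| |r|^(-2)] or [|w| |r|^2], according to the sign of [n]. *)
Lemma triple_product : exists2 Q, Q != 0 & forall w, w != 0 ->
  tends (fun L => \sum_(n <- zrange L) gauss_term r w n) (Q * theta (- (r * w)) p).
Proof.
have [Q Q0 [C hQ]] := euler_prod_cvg; exists Q => // w w0.
have [D D0 hD] := gauss_binom_near Q0 hQ.
have /andP[s0 s1] := nm_r01; have v0 := nm_gt0 w0.
set s := nm r in s0 s1; set v := nm w in v0.
have ps : nm p = s ^+ 2 by rewrite -r2 nmX.
have s20 : 0 < s ^+ 2 by rewrite exprn_gt0.
have [l1 h1] : exists l, tends (fun L => \sum_(n <- zrange L) gauss_term s (v / s ^+ 2) n) l.
  by apply: gauss_sum_cvg; rewrite ?s0 // divr_gt0.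
have [l2 h2] : exists l, tends (fun L => \sum_(n <- zrange L) gauss_term s (v * s ^+ 2) n) l.
  by apply: gauss_sum_cvg; rewrite ?s0 // mulr_gt0.
have rw0 : - (r * w) != 0 by rewrite oppr_eq0 mulf_neq0.
set u := fun L => _.
have -> : u = fun L => (u L - Q * triple_prod r w L) + Q * triple_prod r w L.
  by apply/funext => L; rewrite subrK.
rewrite -[X in tends _ X]add0r; apply: tendsD; last first.
  apply: tendsM (tends_cst _) _; have := theta_tends p_lt1 rw0.
  by apply: tends_near; apply: nearW => m; rewrite theta_triple_prod.
apply: (@tends_le_nm _ _ _ (fun m => D * nm p ^+ m * (\sum_(n <- zrange m) gauss_term s (v / s ^+ 2) n + \sum_(n <- zrange m) gauss_term s (v * s ^+ 2) n))); last first.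
  rewrite -[X in tends _ X](mul0r (l1 + l2)); apply: tendsM; last exact: tendsD.
  exact: geometric_cvg0 (nm_p01 p_lt1).
move=> m; rewrite sub0r nmN /u finite_triple_product // mulr_sumr -sumrB.
apply: le_trans (nm_sum _ _ _) _.
rewrite -big_split /= mulr_sumr big_seq [leRHS]big_seq.
apply: ler_sum => n; rewrite mem_zrange => hn.
rewrite (_ : _ - _ = (1 - Q * gauss_binom (r ^+ 2) (2 * m) (absz (n + m%:Z))) * gauss_term r w n); last by ring.
rewrite nmM nm_gauss_term -/s -/v.
have g0 x : 0 < x -> 0 <= gauss_term s x n by move=> x0; rewrite mulr_ge0 // exprz_ge0 // ltW.
apply: (@le_trans _ _ (D * nm p ^+ (m - absz n) * gauss_term s v n)).
  by rewrite ler_wpM2r ?g0 // r2 hD.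
rewrite -!mulrA ler_wpM2l // ps.
have gE (k : int) : gauss_term s (v * s ^ k) n = gauss_term s v n * s ^ (k * n).
  by rewrite /gauss_term expfzMl exprz_exp mulrA.
have sn0 : s != 0 by rewrite gt_eqF.
have -> : gauss_term s (v / s ^+ 2) n = gauss_term s v n * s ^ (- 2 * n) by rewrite -gE -exprnN.
have -> : gauss_term s (v * s ^+ 2) n = gauss_term s v n * s ^ (2 * n) by rewrite -gE.
rewrite -mulrDr [leRHS]mulrCA [leLHS]mulrC ler_wpM2l ?g0 //.
rewrite -!exprM !exprnP mulrDr -!expfzDr //.
case: n hn {gE g0} => n hn.
  have -> : (2 * (m - absz n))%N%:Z = (2 * m)%N%:Z + -2 * n%:Z by move: hn; clear; lia.
  by rewrite lerDl exprz_ge0 // ltW.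
have -> : (2 * (m - absz (Negz n)))%N%:Z = (2 * m)%N%:Z + 2 * Negz n by move: hn; clear; lia.
by rewrite lerDr exprz_ge0 // ltW.
Qed.

End TripleProductLimit.

(** * Products of two theta functions have rank two *)
(** Index sets for the two ways to sum the double series of
    [theta (x y) theta (x / y)]: by [(m, n)], or by [(m + n, m - n)], where the two lists
    of the diamond hold the pairs with [m + n] even and odd. *)
Definition square L : seq (int * int) := [seq (m, n) | m <- zrange L, n <- zrange L].
Definition diamond L : seq (int * int) :=
  [seq (s + d, s - d) | s <- zrange L, d <- zrange L] ++
  [seq (s + d + 1, s - d) | s <- zrange L, d <- zrange L].

Lemma mem_square L m n : ((m, n) \in square L) = (absz m <= L)%N && (absz n <= L)%N.
Proof.
rewrite -!mem_zrange; apply/allpairsP/andP => [[[a b] [/= ha hb [-> ->]]] //|[hm hn]].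
by exists (m, n).
Qed.

Lemma square_uniq L : uniq (square L).
Proof. by apply: allpairs_uniq; rewrite ?zrange_uniq // => -[a b] [c d]. Qed.

Lemma diamond_uniq L : uniq (diamond L).
Proof.
rewrite cat_uniq; apply/and3P; split.
- apply: allpairs_uniq; rewrite ?zrange_uniq // => -[a b] [c d] _ _ /= [h1 h2].
  by congr (_, _); lia.
- apply/hasPn => -[x y] /allpairsP [[a b] [_ _ /= [-> ->]]].
  by apply/negP => /allpairsP [[c d] [_ _ /= [h1 h2]]]; lia.
- apply: allpairs_uniq; rewrite ?zrange_uniq // => -[a b] [c d] _ _ /= [h1 h2].
  by congr (_, _); lia.
Qed.

Lemma square_sub_diamond L : {subset square L <= diamond L}.
Proof.
move=> [m n]; rewrite mem_square => /andP[hm hn]; rewrite mem_cat.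
have [s hs] : exists s, m + n = 2 * s \/ m + n = 2 * s + 1.
  by exists (divz (m + n) 2); lia.
case: hs => hs; apply/orP; [left|right]; apply/allpairsP; exists (s, s - n) => /=.
  by rewrite !mem_zrange; split; [lia|lia|congr (_, _); lia].
by rewrite !mem_zrange; split; [lia|lia|congr (_, _); lia].
Qed.

Lemma diamond_sub_square L : {subset diamond L <= square (2 * L).+1}.
Proof.
move=> [m n]; rewrite mem_cat mem_square => /orP[] /allpairsP [[s d] [/=]].
  by rewrite !mem_zrange => hs hd [-> ->]; lia.
by rewrite !mem_zrange => hs hd [-> ->]; lia.
Qed.

(** On the diamond the double sum is a sum of two products, since
    [m^2 + n^2] splits as a function of [m + n] plus a function of [m - n]. *)
Lemma diamond_sum (K : fieldType) (r u v : K) L : r != 0 -> u != 0 -> v != 0 ->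
  \sum_(t <- diamond L) gauss_term r u t.1 * gauss_term r v t.2 =
  (\sum_(s <- zrange L) r ^ (2 * s * s) * (u * v) ^ s) * (\sum_(d <- zrange L) r ^ (2 * d * d) * (u / v) ^ d)
  + (r * u) * ((\sum_(s <- zrange L) r ^ (2 * s * s + 2 * s) * (u * v) ^ s) *
      (\sum_(d <- zrange L) r ^ (2 * d * d + 2 * d) * (u / v) ^ d)).
Proof.
move=> r0 u0 v0; rewrite big_cat !big_allpairs_dep /= !mulr_suml mulr_sumr.
have vV (k : int) : v^-1 ^ k = v ^ (- k) by rewrite exprz_inv.
congr (_ + _); apply: eq_bigr => s _; rewrite !mulr_sumr; apply: eq_bigr => d _.
  rewrite /gauss_term !expfzMl vV.
  rewrite [LHS](_ : _ = (r ^ ((s + d) * (s + d)) * r ^ ((s - d) * (s - d))) * u ^ (s + d) * v ^ (s - d)); last by ring.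
  rewrite [RHS](_ : _ = (r ^ (2 * s * s) * r ^ (2 * d * d)) * (u ^ s * u ^ d) * (v ^ s * v ^ (- d))); last by ring.
  by rewrite -!expfzDr //; congr (_ ^ _ * _ ^ _ * _ ^ _); ring.
rewrite /gauss_term !expfzMl vV.
rewrite [LHS](_ : _ = (r ^ ((s + d + 1) * (s + d + 1)) * r ^ ((s - d) * (s - d))) * u ^ (s + d + 1) * v ^ (s - d)); last by ring.
rewrite [RHS](_ : _ = (r ^ (2 * s * s + 2 * s) * r ^ (2 * d * d + 2 * d) * r ^ 1) * (u ^ s * u ^ d * u ^ 1) * (v ^ s * v ^ (- d))); last by rewrite !expr1z; ring.
by rewrite -!expfzDr //; congr (_ ^ _ * _ ^ _ * _ ^ _); ring.
Qed.

Definition det3 (K : pzRingType) (f : nat -> nat -> K) : K :=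
  f 0 0 * (f 1 1 * f 2 2 - f 1 2 * f 2 1)
  - f 0 1 * (f 1 0 * f 2 2 - f 1 2 * f 2 0)
  + f 0 2 * (f 1 0 * f 2 1 - f 1 1 * f 2 0).

Lemma det3_rank2 (K : comPzRingType) (a b c d : nat -> K) :
  det3 (fun i j => a i * b j + c i * d j) = 0.
Proof. by rewrite /det3; ring. Qed.

Lemma det3Z (K : comPzRingType) (c : K) f : det3 (fun i j => c * f i j) = c ^+ 3 * det3 f.
Proof. by rewrite /det3; ring. Qed.

Lemma tends_det3 (K : numFieldType) (g : nat -> nat -> nat -> K) f :
  (forall i j, tends (g i j) (f i j)) ->
  tends (fun L => det3 (fun i j => g i j L)) (det3 f).
Proof.
move=> h.
have h2 i j k l : tends (fun L => g i j L * g k l L) (f i j * f k l) := tendsM (h i j) (h k l).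
apply: tendsD (tendsM (h _ _) (tendsB (h2 _ _ _ _) (h2 _ _ _ _))).
apply: tendsB (tendsM (h _ _) (tendsB (h2 _ _ _ _) (h2 _ _ _ _))).
exact: tendsM (h _ _) (tendsB (h2 _ _ _ _) (h2 _ _ _ _)).
Qed.

Lemma nome_args (K : fieldType) (r x y : K) : r != 0 -> x != 0 -> y != 0 ->
  let u := - (x * y / r) in let v := - (x / (y * r)) in
  [/\ - (r * u) = x * y, - (r * v) = x / y, u * v = x ^+ 2 / r ^+ 2 & u / v = y ^+ 2].
Proof. by move=> r0 x0 y0 u v; split; rewrite ?/u ?/v; field; rewrite ?oppr_eq0 ?r0 ?y0 ?x0. Qed.

Section Rank2.
Local Open Scope classical_set_scope.
Variable R : realType.
Local Notation nm := (@ComplexField.Normc.normc R).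

Lemma sum_sandwich (T : eqType) (A B C : seq T) (F : T -> R[i]) :
  uniq A -> uniq B -> uniq C -> {subset A <= B} -> {subset B <= C} ->
  nm (\sum_(t <- B) F t - \sum_(t <- A) F t) <=
  \sum_(t <- C) nm (F t) - \sum_(t <- A) nm (F t).
Proof.
move=> uA uB uC AB BC.
have split (V : nmodType) (D E : seq T) (G : T -> V) : uniq D -> uniq E -> {subset D <= E} ->
    \sum_(t <- E) G t = \sum_(t <- D) G t + \sum_(t <- E | t \notin D) G t.
  move=> uD uE DE; rewrite (bigID (mem D)) /=; congr (_ + _).
  rewrite -big_filter; apply: perm_big; apply: uniq_perm; rewrite ?filter_uniq // => t.
  by rewrite mem_filter; case: (boolP (t \in D)) => //= /DE.
rewrite (split _ A B) // addrC addKr (split _ A C) // => [|t /AB /BC] //.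
rewrite [leRHS]addrC addKr; apply: le_trans (nm_sum _ _ _) _.
rewrite -big_filter -[leRHS]big_filter.
rewrite [leRHS](split _ [seq t <- B | t \notin A]) ?filter_uniq //.
  by rewrite lerDl sumr_ge0 // => t _; exact: nm_ge0.
by move=> t; rewrite !mem_filter => /andP[-> /BC].
Qed.

Lemma big_square (V : pzSemiRingType) L (F G : int -> V) :
  \sum_(t <- square L) F t.1 * G t.2 = (\sum_(m <- zrange L) F m) * (\sum_(n <- zrange L) G n).
Proof.
rewrite big_allpairs_dep /= mulr_suml; apply: eq_bigr => m _.
by rewrite mulr_sumr.
Qed.

Section Nome.
Variables (p r : R[i]).
Hypotheses (p_lt1 : `|p| < 1) (r2 : r ^+ 2 = p) (r0 : r != 0).

(** The diamond of size [L] lies between the squares of sizes [L] and [2 L + 1], and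
    the absolute double series converges along squares. *)
Lemma gauss_square_diamond u v : u != 0 -> v != 0 ->
  tends (fun L => \sum_(t <- diamond L) gauss_term r u t.1 * gauss_term r v t.2
    - (\sum_(m <- zrange L) gauss_term r u m) * (\sum_(n <- zrange L) gauss_term r v n)) 0.
Proof.
move=> u0 v0; have s01 := nm_r01 p_lt1 r2 r0.
have [a ha] := gauss_sum_cvg s01 (nm_gt0 u0).
have [b hb] := gauss_sum_cvg s01 (nm_gt0 v0).
set E := fun L => (\sum_(m <- zrange L) gauss_term (nm r) (nm u) m) * (\sum_(n <- zrange L) gauss_term (nm r) (nm v) n).
have hE : tends E (a * b) by exact: tendsM.
have hE2 : tends (fun L => E (2 * L).+1) (a * b).
  case: hE => hE; split; apply: (cvg_comp _ _ _ hE).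
  by move=> X [M _ hM]; exists M => // L ML; apply: hM => /=; move: ML; rewrite /=; lia.
apply: (@tends_le_nm _ _ _ (fun L => E (2 * L).+1 - E L)); last first.
  by rewrite -(subrr (a * b)); apply: tendsD hE2 (tendsN hE).
move=> L; rewrite sub0r nmN -big_square /E -!big_square.
have := @sum_sandwich _ (square L) (diamond L) (square (2 * L).+1)
  (fun t => gauss_term r u t.1 * gauss_term r v t.2)
  (square_uniq L) (diamond_uniq L) (square_uniq _) (@square_sub_diamond L) (@diamond_sub_square L).
move/le_trans; apply; rewrite le_eqVlt; apply/orP; left; apply/eqP.
by congr (_ - _); apply: eq_bigr => t _; rewrite nmM !(nm_gauss_term r).
Qed.

(** For [r^2 = p] the triple product is applied at [- x y / r] and [- x / (y r)].  Only
    the sum of the two products has to converge: minors are taken before the limit. *)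
Lemma theta_rank2 : exists A B C D : nat -> R[i] -> R[i], exists2 Q, Q != 0 &
  forall x y, x != 0 -> y != 0 ->
    tends (fun L => A L x * B L y + C L x * D L y) (Q * (theta (x * y) p * theta (x / y) p)).
Proof.
have p_neq0 : p != 0 by rewrite -r2 expf_neq0.
exists (fun L x => \sum_(s <- zrange L) r ^ (2 * s * s) * (x ^+ 2 / p) ^ s).
exists (fun L y => \sum_(s <- zrange L) r ^ (2 * s * s) * (y ^+ 2) ^ s).
exists (fun L x => - x * \sum_(s <- zrange L) r ^ (2 * s * s + 2 * s) * (x ^+ 2 / p) ^ s).
exists (fun L y => y * \sum_(s <- zrange L) r ^ (2 * s * s + 2 * s) * (y ^+ 2) ^ s).
have [Q Q0 hQ] := triple_product p_lt1 r2 r0.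
exists (Q ^+ 2); rewrite ?expf_neq0 // => x y x0 y0.
pose u := - (x * y / r); pose v := - (x / (y * r)).
have u0 : u != 0 by rewrite oppr_eq0 !mulf_neq0 // invr_eq0.
have v0 : v != 0 by rewrite oppr_eq0 !mulf_neq0 // invr_eq0 mulf_neq0.
have h := tendsD (gauss_square_diamond u0 v0) (tendsM (hQ u u0) (hQ v v0)).
have [ru rv uv uv'] := nome_args r0 x0 y0.
rewrite -/u -/v in ru rv uv uv'; rewrite ru rv add0r mulrACA -expr2 in h.
apply: tends_near h; apply: nearW => L; rewrite subrK diamond_sum // uv uv' r2.
by rewrite -[r * u]opprK ru -mulNr mulrACA.
Qed.

End Nome.

Lemma theta_minor (p : R[i]) (p_lt1 : `|p| < 1) (p0 : p != 0) (x y : nat -> R[i]) :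
  (forall i, x i != 0) -> (forall i, y i != 0) ->
  det3 (fun i j => theta (x i * y j) p * theta (x i / y j) p) = 0.
Proof.
move=> x0 y0.
have r0 : sqrtc p != 0 by rewrite sqrtc_eq0.
have [A [B [C [D [Q Q0 h]]]]] := theta_rank2 p_lt1 (sqr_sqrtc p) r0.
have Q3 : Q ^+ 3 != 0 by rewrite expf_neq0.
apply: (mulfI Q3); rewrite mulr0 -det3Z.
have t := tends_det3 (fun i j => h _ _ (x0 i) (y0 j)).
apply: tends_unique t _; apply: tends_near (tends_cst 0); apply: nearW => L.
by rewrite det3_rank2.
Qed.

End Rank2.

(** * The three-term relation *)
(** For the rows [x, y, u] and the columns [x, y, v] the minor equals [h x y] times
    the Pfaffian. *)
Lemma antisymmetric_rank2_pfaffian (K : fieldType) (T : Type) (h : T -> T -> K) :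
  (forall x y, h y x = - h x y) -> (forall x, h x x = 0) ->
  (forall x y : nat -> T, det3 (fun i j => h (x i) (y j)) = 0) ->
  forall x y u v, h x y * h u v - h x u * h y v + h x v * h y u = 0.
Proof.
move=> anti diag minor.
have key x y u v : h x y != 0 -> h x y * h u v - h x u * h y v + h x v * h y u = 0.
  move=> hxy; apply: (mulfI hxy); rewrite mulr0.
  rewrite -(minor (nth u [:: x; y]) (nth v [:: x; y])) /det3 /= !diag.
  by rewrite (anti x y) (anti y u) (anti x u); ring.
move=> x y u v.
have [hxy|] := eqVneq (h x y) 0; last exact: key.
(* The Pfaffian is invariant up to sign under permutations of the points. *)
have [hxu|n] := eqVneq (h x u) 0; last first.
  by have := key x u y v n; rewrite (anti y u) => E; rewrite -[RHS]oppr0 -E; ring.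
have [hxv|n] := eqVneq (h x v) 0; last first.
  by have := key x v y u n; rewrite (anti u v) (anti y v) => <-; ring.
by rewrite hxy hxu hxv !mul0r subrr addr0.
Qed.

(** Weierstrass' relation with an extra scale [a]: for [a = s^2] it is the usual one
    for the points [s x, s y, s u, s v]. *)
Definition three_term (K : fieldType) (th : K -> K) : Prop := forall a x y u v,
  a != 0 -> x != 0 -> y != 0 -> u != 0 -> v != 0 ->
  let g s t := th (a * s * t) * th (s / t) in
  u * (g x u * g y v - g x v * g y u) = y * (g x y * g u v).

Lemma pfaffian_three_term (K : fieldType) (g : K -> K -> K) (x y u v s : K) :
  s != 0 -> x != 0 -> y != 0 -> u != 0 -> v != 0 ->
  let h x y := g x y / (s * x) in
  h x y * h u v - h x u * h y v + h x v * h y u = 0 ->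
  u * (g x u * g y v - g x v * g y u) = y * (g x y * g u v).
Proof.
move=> s0 x0 y0 u0 v0 h; rewrite {}/h.
move: (g x y) (g u v) (g x u) (g y v) (g x v) (g y u) => a b c d e f H.
have : s ^+ 2 * x * y * u * (a / (s * x) * (b / (s * u)) - c / (s * x) * (d / (s * y)) + e / (s * x) * (f / (s * y))) = 0.
  by rewrite H mulr0.
have -> : s ^+ 2 * x * y * u * (a / (s * x) * (b / (s * u)) - c / (s * x) * (d / (s * y)) + e / (s * x) * (f / (s * y))) =
  y * (a * b) - u * (c * d - e * f).
  by field; rewrite s0 x0 y0 u0.
by move/eqP; rewrite subr_eq0 => /eqP.
Qed.

Lemma three_term_of_minors (K : fieldType) (th : K -> K) :
  (forall a : K, exists s, s ^+ 2 = a) -> th 1 = 0 ->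
  (forall z, z != 0 -> th z^-1 = - th z / z) ->
  (forall x y : nat -> K, (forall i, x i != 0) -> (forall i, y i != 0) ->
     det3 (fun i j => th (x i * y j) * th (x i / y j)) = 0) ->
  three_term th.
Proof.
move=> sqrt th1 thV thM a x y u v a0 x0 y0 u0 v0.
have [s s2] := sqrt a.
have s0 : s != 0 by apply: contraNneq a0 => s0; rewrite -s2 s0 expr0n.
pose T := {z : K | z != 0}.
pose h (z t : T) := th (a * sval z * sval t) * th (sval z / sval t) / (s * sval z).
have anti z t : h t z = - h z t.
  case: z t => [z z0] [t t0]; rewrite /h /=.
  have -> : t / z = (z / t)^-1 by rewrite invf_div.
  rewrite thV ?mulf_neq0 ?invr_eq0 //.
  rewrite [a * t * z]mulrAC; move: (th _) (th _) => A B.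
  by field; rewrite s0 t0 z0.
have diag z : h z z = 0.
  by case: z => [z z0]; rewrite /h /= divff // th1 mulr0 mul0r.
have minor (X Y : nat -> T) : det3 (fun i j => h (X i) (Y j)) = 0.
  have n0 (Z : nat -> T) i : s * sval (Z i) != 0 by case: (Z i) => z z0; rewrite mulf_neq0.
  have := thM _ _ (n0 X) (n0 Y).
  set f := (F in det3 F); have hf i j : h (X i) (Y j) = f i j / (s * sval (X i)).
    rewrite /h /f; congr (th _ * th _ / _); first by rewrite -s2 expr2; ring.
    by rewrite -mulf_div divff // mul1r.
  rewrite /det3 !hf; set D := (F in F = 0) => E.
  transitivity (D * ((s * sval (X 0%N))^-1 * (s * sval (X 1%N))^-1 * (s * sval (X 2%N))^-1)).
    by rewrite /D; ring.
  by rewrite E mul0r.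
have := antisymmetric_rank2_pfaffian anti diag minor (exist _ x x0) (exist _ y y0) (exist _ u u0) (exist _ v v0).
exact: (@pfaffian_three_term _ (fun z t => th (a * z * t) * th (z / t)) x y u v s).
Qed.

Section ThetaThreeTerm.
Variables (R : realType) (p : R[i]).
Hypothesis p_lt1 : `|p| < 1.

Lemma theta_nome0 (z : R[i]) : z != 0 -> theta z 0 = 1 - z.
Proof.
move=> z0; apply: theta_lim; apply: tends_near (tends_cst _).
exists 1%N => // -[|n] // _; rewrite big_nat_recl // big1 => [|j _].
  by rewrite /theta_factor expr0 expr1 mul0r subr0 !mulr1.
by rewrite /theta_factor !expr0n /= mulr0 mul0r subr0 mulr1.
Qed.

Lemma three_term_linear (K : fieldType) (a x y u v : K) : 
  a != 0 -> x != 0 -> y != 0 -> u != 0 -> v != 0 ->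
  let g s t := (1 - a * s * t) * (1 - s / t) in
  u * (g x u * g y v - g x v * g y u) = y * (g x y * g u v).
Proof. by move=> a0 x0 y0 u0 v0 g; rewrite /g; field; rewrite ?u0 ?v0 ?y0. Qed.

(** The case [p = 0], where the triple product has no square root of [p] to divide by,
    is an identity between polynomials. *)
Lemma theta_three_term : three_term (fun z : R[i] => theta z p).
Proof.
have [p0|p0] := eqVneq p 0.
  move=> a x y u v a0 x0 y0 u0 v0; rewrite /= p0 !theta_nome0 ?mulf_neq0 ?invr_eq0 //.
  exact: three_term_linear.
apply: three_term_of_minors => //; first by move=> z; exists (sqrtc z); exact: sqr_sqrtc.
- exact: theta1.
- by move=> z; exact: thetaV.
- by move=> X Y X0 Y0; exact: theta_minor.
Qed.

End ThetaThreeTerm.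

(** * Partial fractions *)
(** What the summation formulas need to know about theta. *)
Record theta_like (K : fieldType) (th : K -> K) : Prop := ThetaLike {
  th_one : th 1 = 0;
  th_inv : forall z, z != 0 -> th z^-1 = - th z / z;
  th_three_term : three_term th;
  th_div_eq0 : forall x y, x != 0 -> y != 0 -> th x = 0 -> th y = 0 -> th (x / y) = 0
}.

Section PartialFractions.
Variables (K : fieldType) (th : K -> K).
Hypothesis thP : theta_like th.

Let th1 := th_one thP.
Let thV := th_inv thP.

Lemma th_inv_neq0 z : z != 0 -> th z != 0 -> th z^-1 != 0.
Proof. by move=> z0 tz; rewrite thV // mulf_neq0 ?oppr_eq0 ?invr_eq0. Qed.

(** The relation between the [x] and the [y] makes the second term the image of the first
    one under the inversion of all arguments. *)
Lemma partial_fractions2 (x x' y y' : K) : x != 0 -> x' != 0 -> y != 0 -> y' != 0 ->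
  y * y' = x * x' -> th (x / x') != 0 ->
  th (x / y) * th (x / y') / th (x / x') + th (x' / y) * th (x' / y') / th (x' / x) = 0.
Proof.
move=> x0 x'0 y0 y'0 e t0.
have -> : x' / x = (x / x')^-1 by rewrite invf_div.
have -> : x' / y = (x / y')^-1.
  by rewrite invf_div; apply/eqP; rewrite eqr_div // [y' * y]mulrC e mulrC.
have -> : x' / y' = (x / y)^-1.
  by rewrite invf_div; apply/eqP; rewrite eqr_div // e mulrC.
rewrite !thV ?mulf_neq0 ?invr_eq0 //.
have -> : x / x' = (x / y) * (x / y').
  by rewrite mulf_div e -mulf_div divff // mul1r.
move: t0; have -> : x / x' = (x / y) * (x / y').
  by rewrite mulf_div e -mulf_div divff // mul1r.
have a0 : x / y != 0 by rewrite mulf_neq0 ?invr_eq0.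
have b0 : x / y' != 0 by rewrite mulf_neq0 ?invr_eq0.
move: (x / y) (x / y') a0 b0 => a b a0 b0 t0.
by field; rewrite ?oppr_eq0 t0 a0 b0.
Qed.

(** Induction on the number of points.  By the three-term relation, the product
    [th (t / y) th (t y / w)], for fixed [w], lies in the span of the same products with
    [y] replaced by [x_i] or [x_j].  With [y = x_i] the term at [x_i] disappears and the
    factors [th (x_r / x_i)] cancel, which leaves the identity for the other points.  This
    needs [th (x_i x_j / w)] to be nonzero; among three points there is such a pair,
    because zeros are stable under quotients. *)
Lemma partial_fractions (I : finType) (x : I -> K) (A : {set I}) (ys : seq K) :
  (forall i, x i != 0) -> all (fun y => y != 0) ys -> size ys = #|A| ->
  \prod_(y <- ys) y = \prod_(i in A) x i ->
  {in A &, forall i j, i != j -> th (x i / x j) != 0} ->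
  \sum_(r in A) (\prod_(y <- ys) th (x r / y)) / (\prod_(j in A :\ r) th (x r / x j)) = 0.
Proof.
move=> x0; have [n] := ubnP #|A|; elim: n A ys => // n IH A ys An ys0 sz bal gen.
have [A3|] := ltnP 2 #|A|; last first.
  case: ys ys0 sz bal => [|y [|y' [|? ?]]] //= ys0 sz bal.
  - by rewrite (cards0_eq (esym sz)) big_set0.
  - move=> _; have /cards1P [i Ai] : #|A| == 1%N by rewrite -sz.
    move: bal; rewrite Ai !big_set1 !big_seq1 => ->.
    by rewrite divff ?x0 // th1 mul0r.
  - move=> _; have /cards2P [i [j [ij Ai]]] : #|A| == 2 by rewrite -sz.
    move: bal ys0; rewrite Ai !big_setU1 ?inE //= !big_set1 !big_cons !big_nil !mulr1.
    move=> bal /and3P [y0 y'0 _].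
    have -> : [set i; j] :\ i = [set j].
      by apply/setP => k; rewrite !inE; case: (eqVneq k i) => // ->; rewrite (negPf ij).
    have -> : [set i; j] :\ j = [set i].
      by apply/setP => k; rewrite !inE; case: (eqVneq k j) => [->|] //=; rewrite ?orbF // eq_sym (negPf ij).
    rewrite !big_set1; apply: partial_fractions2 => //.
    by apply: gen; rewrite ?Ai ?inE ?eqxx ?orbT.
  - by rewrite -sz.
case: ys ys0 sz bal => [|y [|y' ys]]; rewrite /= ?big_cons.
- by move=> _ sz; rewrite -sz in A3.
- by move=> _ sz; rewrite -sz in A3.
move=> /and3P[y0 y'0 ys0] sz bal.
set w := y * y'; have w0 : w != 0 by rewrite mulf_neq0.
pose S i := \sum_(r in A) (th (w^-1 * x r * x i) * th (x r / x i)) * (\prod_(y <- ys) th (x r / y)) /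
       (\prod_(j in A :\ r) th (x r / x j)).
have reduced i : i \in A -> S i = 0.
  move=> Ai; rewrite /S (big_setD1 i) //= divff // th1 mulr0 !mul0r add0r.
  have := IH (A :\ i) (w / x i :: ys); rewrite big_cons /= => H.
  apply: etrans (H _ _ _ _ _); first last.
  - by move=> r s /setD1P [_ Ar] /setD1P[_ As]; exact: gen.
  - by apply: (mulfI (x0 i)); rewrite -(big_setD1 i) //= -bal /w; field; rewrite x0.
  - by move: sz; rewrite (cardsD1 i A) Ai add1n => -[->].
  - by rewrite !mulf_neq0 ?invr_eq0.
  - by move: An; rewrite (cardsD1 i A) Ai.
  apply: eq_bigr => r /setD1P [ri Ar].
  rewrite big_cons [in LHS](big_setD1 i); last by rewrite !inE eq_sym ri.
  have -> : (A :\ r) :\ i = (A :\ i) :\ r by apply/setP => k; rewrite !inE andbCA.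
  have -> : x r / (w / x i) = w^-1 * x r * x i by rewrite invf_div; ring.
  rewrite /= [(th (x r / x i) * _)^-1]invfM; move: (gen r i Ar Ai ri) (\prod_(_ in _) _)^-1 (\prod_(_ <- _) _) => tri Q P.
  by field.
have [i [j [Ai Aj ij tij]]] : exists i j, [/\ i \in A, j \in A, i != j & th (w^-1 * x i * x j) != 0].
  have /card_gt2P [i [j [k [[Ai Aj Ak] [ij jk ki]]]]] := A3.
  have [tij|] := eqVneq (th (w^-1 * x i * x j)) 0; last by exists i, j.
  have [tik|] := eqVneq (th (w^-1 * x i * x k)) 0; last by exists i, k; rewrite eq_sym.
  have := th_div_eq0 thP _ _ tij tik; rewrite -mulf_div divff ?mul1r ?mulf_neq0 ?invr_eq0 //.
  move=> /(_ isT isT) /eqP; by rewrite (negPf (gen _ _ Aj Ak jk)).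
set g := fun s t => th (w^-1 * s * t) * th (s / t).
have gij : g (x i) (x j) != 0 by rewrite mulf_neq0 // gen.
have E r : th (x r / y) * th (x r / y') =
   x i / (y * g (x i) (x j)) * g y (x j) * g (x r) (x i) - x i / (y * g (x i) (x j)) * g y (x i) * g (x r) (x j).
  have wV : w^-1 != 0 by rewrite invr_eq0.
  have T := th_three_term thP wV (x0 r) y0 (x0 i) (x0 j).
  have -> : th (x r / y) * th (x r / y') = g (x r) y.
    rewrite /g mulrC; congr (th _ * th _); rewrite /w; field; by rewrite y0 y'0.
  apply: (mulfI gij); apply: (mulfI y0); rewrite [g (x i) (x j) * g (x r) y]mulrC -T -/(g _ _).
  rewrite /= -!/(g _ _); field; by rewrite gij y0.
transitivity (x i / (y * g (x i) (x j)) * g y (x j) * S i - x i / (y * g (x i) (x j)) * g y (x i) * S j).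
  rewrite !mulr_sumr -sumrB; apply: eq_bigr => r _.
  rewrite !big_cons mulrA E -!/(g _ _); ring.
by rewrite !reduced // !mulr0 subrr.
Qed.

Lemma prod_th_inv (s : seq K) t : t != 0 -> all (fun y => y != 0) s ->
  \prod_(y <- s) th (t * y)^-1 = (- t^-1) ^+ size s * (\prod_(y <- s) th (t * y)) / \prod_(y <- s) y.
Proof.
move=> t0; elim: s => [|y s IH] /=; first by rewrite !big_nil expr0 invr1 !mulr1.
move=> /andP[y0 s0]; rewrite !big_cons IH // thV ?mulf_neq0 //.
have P0 : \prod_(y <- s) y != 0 by rewrite prodf_seq_neq0.
rewrite exprS; field; by rewrite P0 y0 t0.
Qed.

Lemma prod_ordS_neq (n : nat) (F : 'I_n.+1 -> K) :
  \prod_(j | j != ord0) F j = \prod_(j < n) F (lift ord0 j).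
Proof. by rewrite big_mkcond big_ord_recl /= mul1r; apply: eq_bigr. Qed.

(** The identity with the additional point [1/t] isolated on the right. *)
Lemma partial_fractions_pole n (x : 'I_n -> K) (t : K) (ys : seq K) :
  (forall i, x i != 0) -> t != 0 -> all (fun y => y != 0) ys -> size ys = n.+1 ->
  t * \prod_(y <- ys) y = \prod_i x i ->
  (forall i j, i != j -> th (x i / x j) != 0) -> (forall i, th (t * x i) != 0) ->
  \sum_i (\prod_(y <- ys) th (x i / y)) / (\prod_(j | j != i) th (x i / x j) * th (t * x i))
  = (\prod_(y <- ys) th (t * y)) / \prod_i th (t * x i).
Proof.
move=> x0 t0 ys0 sz bal gen pole.
have -> : (\prod_(y <- ys) th (t * y)) / \prod_i th (t * x i) =
    - (\prod_(y <- ys) th (t * y)^-1) / \prod_i th (t * x i)^-1.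
  rewrite -[X in - _ / X](big_map x xpredT (fun y => th (t * y)^-1)).
  rewrite -[X in _ / X = _](big_map x xpredT (fun y => th (t * y))).
  have xs0 : all (fun y => y != 0) (map x (index_enum 'I_n)) by apply/allP => y /mapP[i _ ->].
  rewrite !prod_th_inv // sz size_map.
  have -> : size (index_enum (fintype_ordinal__canonical__fintype_Finite n)) = n by rewrite -sum1_size big_const_ord iter_addn mul1n addn0.
  rewrite [X in _ / (_ / X)]big_map.
  rewrite -bal exprS.
  have P0 : \prod_(y <- ys) y != 0 by rewrite prodf_seq_neq0.
  have Q0 : \prod_(y <- map x (index_enum 'I_n)) th (t * y) != 0.
    by rewrite big_map prodf_seq_neq0; apply/allP => i _; rewrite pole.
  have T0 : (- t^-1) ^+ n != 0 by rewrite expf_neq0 // oppr_eq0 invr_eq0.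
  move: P0 Q0 T0; move: (\prod_(y <- ys) y) (\prod_(_ <- map _ _) _) ((- t^-1) ^+ n) => P Q T P0 Q0 T0.
  by field; rewrite P0 Q0 T0 t0.
pose X (k : 'I_n.+1) := if unlift ord0 k is Some i then x i else t^-1.
have X0 k : X k != 0 by rewrite /X; case: unliftP => [i _|_]; rewrite ?invr_eq0.
have Xl i : X (lift ord0 i) = x i by rewrite /X liftK.
have Xz : X ord0 = t^-1 by rewrite /X unlift_none.
have H : \sum_k (\prod_(y <- ys) th (X k / y)) / (\prod_(j | j != k) th (X k / X j)) = 0.
  apply: etrans _ (@partial_fractions _ X (finset.setT : {set _}) ys X0 ys0 _ _ _).
  - by apply: eq_big => [k|k _]; rewrite ?inE //; congr (_ / _); apply: eq_bigl => j; rewrite !inE andbT.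
  - by rewrite cardsT card_ord.
  - rewrite [RHS](eq_bigl xpredT) => [|j]; last by rewrite inE.
    rewrite big_ord_recl Xz (eq_bigr x) => [|i _]; last exact: Xl.
    by rewrite -bal mulKf.
  move=> i j _ _; case: (unliftP ord0 i) => [i' ->|->]; case: (unliftP ord0 j) => [j' ->|->]; rewrite ?eqxx ?Xl ?Xz //.
  - by rewrite (inj_eq (@lift_inj _ _)); exact: gen.
  - by rewrite invrK mulrC => _; exact: pole.
  - by rewrite -invfM => _; apply: th_inv_neq0; rewrite ?pole ?mulf_neq0.
move: H; rewrite big_ord_recl prod_ordS_neq Xz => /eqP; rewrite addr_eq0 => /eqP H.
rewrite mulNr; have -> : (\prod_(y <- ys) th (t * y)^-1) / \prod_i th (t * x i)^-1 =
   (\prod_(y <- ys) th (t^-1 / y)) / \prod_(j < n) th (t^-1 / X (lift ord0 j)).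
  congr (_ / _); first by apply: eq_bigr => y _; rewrite invfM.
  by apply: eq_bigr => j _; rewrite Xl invfM.
rewrite H opprK; apply: eq_bigr => i _; rewrite Xl; congr (_ / _).
rewrite [RHS]big_mkcond big_ord_recl /= Xz invrK [RHS]mulrC [t * x i]mulrC; congr (_ * _).
by rewrite [LHS]big_mkcond; apply: eq_bigr => j _; rewrite (inj_eq (@lift_inj _ _)) Xl.
Qed.

End PartialFractions.

(** * Shifted factorials, and Rosengren's sum over the simplex *)
Section ShiftedFactorial.
Variables (K : fieldType) (th : K -> K) (q : K).

(** For [th = theta _ p] this is convertible to the [q,p]-shifted factorial [qpfact]. *)
Definition pfact a k := \prod_(0 <= j < k) th (a * q ^+ j).

Lemma pfact0 a : pfact a 0 = 1.
Proof. by rewrite /pfact big_geq. Qed.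

Lemma pfactS a k : pfact a k.+1 = pfact a k * th (a * q ^+ k).
Proof. by rewrite /pfact big_nat_recr. Qed.

Lemma pfactSl a k : pfact a k.+1 = th a * pfact (a * q) k.
Proof.
rewrite /pfact big_nat_recl // expr0 mulr1; congr (_ * _).
by apply: eq_bigr => j _; rewrite exprS mulrA.
Qed.

Lemma pfact_neq0 a k : (forall j, (j < k)%N -> th (a * q ^+ j) != 0) -> pfact a k != 0.
Proof.
move=> h; rewrite prodf_seq_neq0; apply/allP => j; rewrite mem_index_iota => /andP[_ jk].
by rewrite h.
Qed.
End ShiftedFactorial.

Section Vandermonde.
Variables (K : fieldType) (th : K -> K).
Hypothesis thP : theta_like th.
Variable n : nat.
Implicit Types X : 'I_n -> K.

Definition vandermonde X := \prod_(r < n) \prod_(s < n | (r < s)%N) (X s * th (X r / X s)).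

Definition scale_at (i : 'I_n) (q : K) X := fun j => if j == i then q * X i else X j.

(** Only the pairs containing [i] change.  For the pairs [(r, i)] with [r < i] the factor
    [X_i] turns the inversion formula into an antisymmetry. *)
Lemma vandermonde_scale_at i q X : q != 0 -> (forall j, X j != 0) ->
  (forall j, j != i -> th (X i / X j) != 0) ->
  vandermonde (scale_at i q X) =
  vandermonde X * \prod_(j | j != i) (th (q * X i / X j) / th (X i / X j)).
Proof.
move=> q0 X0 gen; set rho := fun j => th (q * X i / X j) / th (X i / X j).
have swap Y j : Y != 0 -> j != i -> Y * th (X j / Y) = - X j * th (Y / X j).
  move=> Y0 ji; have -> : X j / Y = (Y / X j)^-1 by rewrite invf_div.
  rewrite (th_inv thP) ?mulf_neq0 ?invr_eq0 //; move: (th _) => t.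
  by field; rewrite Y0 X0.
transitivity (\prod_(r < n) \prod_(s < n | (r < s)%N) (X s * th (X r / X s) *
    ((if r == i then rho s else 1) * (if s == i then rho r else 1)))).
  apply: eq_bigr => r _; apply: eq_bigr => s rs; rewrite /scale_at.
  have [ri|ri] := eqVneq r i.
    have si : s != i by rewrite -ri -val_eqE /= gtn_eqF.
    rewrite (negPf si) mulr1 /rho ri -[RHS]mulrA; congr (_ * _).
    by rewrite [RHS]mulrC divfK // gen.
  have [si|si] := eqVneq s i; last by rewrite !mulr1.
  rewrite mul1r swap ?mulf_neq0 // si swap //.
  by rewrite /rho -[RHS]mulrA [th (X i / X r) * _]mulrC divfK // gen.
have split2 (F G : 'I_n -> 'I_n -> K) :
    \prod_(r < n) \prod_(s < n | (r < s)%N) (F r s * G r s) =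
    (\prod_(r < n) \prod_(s < n | (r < s)%N) F r s) * \prod_(r < n) \prod_(s < n | (r < s)%N) G r s.
  by rewrite -big_split; apply: eq_bigr => r _; rewrite -big_split.
rewrite split2 -/(vandermonde X); congr (_ * _); rewrite split2.
rewrite [RHS](bigID (fun j : 'I_n => (i < j)%N)) /=; congr (_ * _).
  rewrite (bigD1 i) //= [X in _ * X]big1 ?mulr1 => [|r /negPf ri]; last by apply: big1 => s _; rewrite ri.
  by apply: eq_big => [s|s _]; rewrite ?eqxx //; case: eqVneq => [->|]; rewrite ?ltnn.
rewrite [RHS]big_mkcond; apply: eq_bigr => r _.
rewrite -big_mkcondr /=.
have [ri|ir] := ltnP r i.
  rewrite (big_pred1 i) => [|s]; last by rewrite /= andbC; case: eqVneq => // ->; rewrite ri.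
  by rewrite neq_ltn ri /= -leqNgt ltnW.
rewrite big_pred0 => [|s]; last by rewrite andbC; case: eqVneq => //= ->; rewrite ltnNge ir.
by rewrite -leqNgt -val_eqE -eqn_leq' || (case: eqVneq => //= /negPf ne; case: ltngtP ir => // /val_inj; move/eqP; rewrite eq_sym ne).
Qed.
End Vandermonde.

Section Reindex.
Variables (n M : nat).
Implicit Types k m : {ffun 'I_n -> 'I_M.+1}.

(** The substitution [k = m + e_i].  The values live in a bounded type, and [inord] sends an
    overflow to 0; the condition [0 < k i] excludes it. *)
Definition incf (i : 'I_n) m : {ffun 'I_n -> 'I_M.+1} := [ffun j => inord (m j + (j == i))].
Definition decf (i : 'I_n) m : {ffun 'I_n -> 'I_M.+1} := [ffun j => inord (m j - (j == i))].

Lemma incfE i m j : (m i < M)%N -> incf i m j = (m j + (j == i))%N :> nat.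
Proof.
move=> h; rewrite ffunE inordK //; case: eqVneq => [->|_]; first by rewrite addn1 ltnS.
by rewrite addn0.
Qed.

Lemma sum_incf i m : (m i < M)%N -> (\sum_j incf i m j = (\sum_j m j).+1)%N.
Proof.
move=> h; under eq_bigr do rewrite incfE //.
rewrite big_split /= -[RHS]addn1; congr (_ + _)%N.
by rewrite (bigD1 i) //= eqxx big1 ?addn0 // => j /negPf ->.
Qed.

Lemma sum_incf_reindex (V : nmodType) (F : {ffun 'I_n -> 'I_M.+1} -> V) i K : (K < M)%N ->
  \sum_(k : {ffun 'I_n -> 'I_M.+1} | ((\sum_j k j)%N == K.+1) && (0 < k i)%N) F k =
  \sum_(m : {ffun 'I_n -> 'I_M.+1} | (\sum_j m j)%N == K) F (incf i m).
Proof.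
move=> KM; rewrite (reindex_onto (incf i) (decf i)) /=; last first.
  move=> k /andP[_ ki]; apply/ffunP => j; apply: val_inj; rewrite !ffunE /=.
  have e : (inord (k j - (j == i)) : 'I_M.+1) = (k j - (j == i))%N :> nat.
    by rewrite inordK // (leq_ltn_trans (leq_subr _ _)).
  rewrite e subnK ?inordK //; case: eqVneq => // ->; exact: ki.
apply: eq_bigl => m; apply/andP/idP => [[/andP[s p] /eqP e]|/eqP s].
  have h : (m i < M)%N.
    rewrite ltn_neqAle -ltnS ltn_ord andbT; apply: contraTneq p => mi.
    rewrite -leqNgt leqn0 ffunE eqxx mi addn1 /inord /insubd insubF //.
    by rewrite ltnn.
  by move: s; rewrite sum_incf // eqSS.
have h : (m i < M)%N.
  by apply: leq_ltn_trans KM; rewrite -s (bigD1 i) //= leq_addr.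
rewrite sum_incf // s eqxx incfE // eqxx addn1; split=> //.
apply/eqP/ffunP => j; apply: val_inj; rewrite !ffunE.
have e : (inord (m j + (j == i)) : 'I_M.+1) = (m j + (j == i))%N :> nat by have := incfE j h; rewrite ffunE.
by rewrite e addnK inord_val.
Qed.

End Reindex.

Section RosengrenSum.
Variables (K : fieldType) (th : K -> K) (q : K).
Hypotheses (thP : theta_like th) (q0 : q != 0).
Variables (n M : nat) (z : 'I_n -> K) (as_ : seq K).
Hypothesis z0 : forall i, z i != 0.
Hypothesis as0 : all (fun al => al != 0) as_.
Hypothesis size_as : size as_ = n.+1.
Let b := \prod_(al <- as_) al * \prod_i z i.
Hypothesis genz : forall r s i j, r != s -> (i <= M)%N -> (j <= M)%N ->
  th (q ^+ i * z r / (q ^+ j * z s)) != 0.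
Hypothesis genq : forall i, (0 < i <= M)%N -> th (q ^+ i) != 0.
Hypothesis genb : forall i r, (i <= 2 * M)%N -> th (b * z r * q ^+ i) != 0.

Local Notation pf := (pfact th q).

Definition shift (k : 'I_n -> nat) r := q ^+ k r * z r.

Definition rosengren_factor i k :=
  (\prod_(al <- as_) pf (al * z i) k) / (pf (b * z i) k * \prod_j pf (q * z i / z j) k).

(** The summand, with the Vandermonde quotient taken at the points [q^(k_r) z_r]. *)
Definition rosengren_term (k : 'I_n -> nat) :=
  vandermonde th (shift k) / vandermonde th z * \prod_i rosengren_factor i (k i).

Lemma b_neq0 : b != 0.
Proof.
rewrite mulf_neq0 //; first by rewrite prodf_seq_neq0.
by apply/prodf_neq0.
Qed.

Lemma shift_neq0 k r : shift k r != 0.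
Proof. by rewrite mulf_neq0 ?expf_neq0. Qed.

Lemma prod_shift k : \prod_r shift k r = q ^+ (\sum_r k r) * \prod_r z r.
Proof. by rewrite big_split /= -expr_sum. Qed.

Definition incn (i : 'I_n) (m : 'I_n -> nat) j := (m j + (j == i))%N.

Lemma shift_inc i m : shift (incn i m) =1 scale_at i q (shift m).
Proof.
move=> j; rewrite /shift /incn /scale_at; case: eqVneq => [->|_]; last by rewrite addn0.
by rewrite addn1 exprS mulrA.
Qed.

Lemma vandermonde_ext (X Y : 'I_n -> K) : X =1 Y -> vandermonde th X = vandermonde th Y.
Proof. by move=> e; apply: eq_bigr => r _; apply: eq_bigr => s _; rewrite !e. Qed.

Lemma rosengren_factorS i m : rosengren_factor i m.+1 = rosengren_factor i m *
  ((\prod_(al <- as_) th (al * (q ^+ m * z i))) /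
     (th (b * (q ^+ m * z i)) * \prod_j th (q * (q ^+ m * z i) / z j))).
Proof.
rewrite /rosengren_factor pfactS.
have -> : \prod_(al <- as_) pf (al * z i) m.+1 =
    (\prod_(al <- as_) pf (al * z i) m) * \prod_(al <- as_) th (al * (q ^+ m * z i)).
  rewrite -big_split; apply: eq_bigr => al _ /=; rewrite pfactS; congr (_ * th _); ring.
have -> : \prod_j pf (q * z i / z j) m.+1 =
    (\prod_j pf (q * z i / z j) m) * \prod_j th (q * (q ^+ m * z i) / z j).
  rewrite -big_split; apply: eq_bigr => j _ /=; rewrite pfactS; congr (_ * th _); ring.
have -> : b * z i * q ^+ m = b * (q ^+ m * z i) by ring.
by rewrite !invfM; ring.
Qed.

Lemma rosengren_term_inc i m : (forall j, (m j <= M)%N) ->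
  rosengren_term (incn i m) = rosengren_term m *
   ((\prod_(j | j != i) (th (q * shift m i / shift m j) / th (shift m i / shift m j))) *
   ((\prod_(al <- as_) th (al * shift m i)) /
     (th (b * shift m i) * \prod_j th (q * shift m i / z j)))).
Proof.
move=> mM; rewrite /rosengren_term (vandermonde_ext (shift_inc i m)).
rewrite (vandermonde_scale_at thP q0 (shift_neq0 m)); last first.
  by move=> j ji; apply: genz; rewrite // eq_sym.
have -> : \prod_j rosengren_factor j (incn i m j) = (\prod_j rosengren_factor j (m j)) *
   ((\prod_(al <- as_) th (al * shift m i)) / (th (b * shift m i) * \prod_j th (q * shift m i / z j))).
  rewrite (bigD1 i) // [in RHS](bigD1 i) //= /incn eqxx addn1 rosengren_factorS.
  rewrite [RHS]mulrAC; congr (_ * _); apply: eq_bigr => j /negPf ->; by rewrite addn0.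
ring.
Qed.

(** Terms of the partial fraction expansion with poles at the points [shift k i] and
    [1 / t], and zeros at the [z_j] and at [q / b].  The zero at [z_i] kills the term if
    [k_i = 0]. *)
Definition split_coef t k i :=
  (th (shift k i / (q / b)) * \prod_j th (shift k i / z j)) /
  (\prod_(j | j != i) th (shift k i / shift k j) * th (t * shift k i)).
Definition split_total t k :=
  (th (t * (q / b)) * \prod_j th (t * z j)) / \prod_j th (t * shift k j).

Lemma t_shift N k j : (N + k j <= 2 * M)%N -> th (b * q ^+ N * shift k j) != 0.
Proof.
move=> h; have := genb j h; congr (th _ != _); rewrite exprD /shift; ring.
Qed.

(** For [t = b q^N] the points are balanced exactly when [|k| = N + 1]. *)
Lemma split_sum N k : (\sum_j k j = N.+1)%N -> (N < M)%N ->
  \sum_i split_coef (b * q ^+ N) k i = split_total (b * q ^+ N) k.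
Proof.
move=> kN NM; have kM j : (k j <= M)%N.
  by apply: leq_trans NM; rewrite -kN (bigD1 j) //= leq_addr.
have t0 : b * q ^+ N != 0 by rewrite mulf_neq0 ?expf_neq0 ?b_neq0.
have zs0 : all (fun y => y != 0) (map z (index_enum 'I_n)) by apply/allP => y /mapP[i _ ->].
have := @partial_fractions_pole _ _ thP n (shift k) (b * q ^+ N) (q / b :: map z (index_enum 'I_n)) (shift_neq0 k) t0.
rewrite /= zs0 mulf_neq0 ?invr_eq0 ?b_neq0 // => /(_ isT).
have -> : size (map z (index_enum 'I_n)) = n by rewrite size_map -sum1_size big_const_ord iter_addn mul1n addn0.
move=> /(_ erefl).
have e i : \prod_(y <- q / b :: map z (index_enum 'I_n)) th (shift k i / y) = th (shift k i / (q / b)) * \prod_j th (shift k i / z j).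
  by rewrite big_cons big_map.
rewrite /split_coef /split_total => H.
have {}H := H _ _ _.
rewrite !big_cons !big_map in H; rewrite -H.
- by apply: eq_bigr => i _; rewrite e.
- rewrite prod_shift kN exprS; field; exact: b_neq0.
- by move=> i j ij; apply: genz.
- by move=> i; apply: t_shift; have := kM i; lia.
Qed.

Lemma split_total_neq0 N k : (\sum_j k j = N.+1)%N -> (N < M)%N -> split_total (b * q ^+ N) k != 0.
Proof.
move=> kN NM; have kM j : (k j <= M)%N.
  by apply: leq_trans NM; rewrite -kN (bigD1 j) //= leq_addr.
rewrite !mulf_neq0 ?invr_eq0 //.
- have -> : b * q ^+ N * (q / b) = q ^+ N.+1 by rewrite exprS; field; exact: b_neq0.
  by apply: genq.
- apply/prodf_neq0 => j _; have := @t_shift N (fun=> 0%N) j; rewrite /shift expr0 mul1r; apply; lia.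
- by apply/prodf_neq0 => i _; apply: t_shift; have := kM i; lia.
Qed.

(** What becomes of [split_coef] after the substitution [k = m + e_i]: the factors
    [th (q Z_i / z_j)] cancel with the new factors of the summand, and the zeros are now at
    the inverses of the numerator parameters. *)
Definition merge_coef t N m i :=
  (\prod_(al <- as_) th (al * shift m i)) / (\prod_(j | j != i) th (shift m i / shift m j) * th (t * shift m i)) *
  ((\prod_j th (t * shift m j)) / (th (q ^+ N.+1) * \prod_j th (t * z j))).

(** For [k = m + e_i] and [X_i = q^(k_i) z_i], the factor [th (X_i b / q)] of [split_coef]
    is the last factor of the denominator [(b z_i)_(k_i)], and cancels. *)
Lemma split_term_inc N m i : (\sum_j m j = N)%N -> (N < M)%N ->
  rosengren_term (incn i m) * (split_coef (b * q ^+ N) (incn i m) i / split_total (b * q ^+ N) (incn i m))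
  = rosengren_term m * merge_coef (b * q ^+ N) N m i.
Proof.
move=> mN NM; have mM j : (m j < M)%N.
  by apply: leq_ltn_trans NM; rewrite -mN (bigD1 j) //= leq_addr.
rewrite rosengren_term_inc => [|j]; last exact: ltnW.
rewrite -mulrA; congr (_ * _).
set t := b * q ^+ N.
have e1 : shift (incn i m) i = q * shift m i by rewrite shift_inc /scale_at eqxx.
have e2 j : j != i -> shift (incn i m) j = shift m j.
  by rewrite shift_inc /scale_at => /negPf ->.
rewrite /split_coef /split_total /merge_coef e1.
have -> : q * shift m i / (q / b) = b * shift m i by field; rewrite q0 b_neq0.
have -> : t * (q / b) = q ^+ N.+1 by rewrite /t exprS; field; exact: b_neq0.
have -> : \prod_(j | j != i) th (q * shift m i / shift (incn i m) j) = \prod_(j | j != i) th (q * shift m i / shift m j).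
  by apply: eq_bigr => j ji; rewrite e2.
rewrite [\prod_j th (t * shift (incn i m) j)](bigD1 i) //= e1 [\prod_j th (t * shift m j)](bigD1 i) //=.
have -> : \prod_(j | j != i) th (t * shift (incn i m) j) = \prod_(j | j != i) th (t * shift m j).
  by apply: eq_bigr => j ji; rewrite e2.
rewrite prodf_div.
have n1 : \prod_(j | j != i) th (q * shift m i / shift m j) != 0.
  apply/prodf_neq0 => j ji; have := @genz i j (m i).+1 (m j).
  by rewrite exprS -[q * _ * _]mulrA; apply => //; [rewrite eq_sym|exact: ltnW].
have n2 : th (b * shift m i) != 0.
  by have := @t_shift 0 m i; rewrite expr0 mulr1; apply; have := mM i; lia.
have n3 : \prod_j th (q * shift m i / z j) != 0.
  apply/prodf_neq0 => j _; have [->|ij] := eqVneq j i.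
    rewrite (_ : q * shift m i / z i = q ^+ (m i).+1); first by apply: genq; rewrite /= mM.
    by rewrite /shift exprS; field.
  by have := @genz i j (m i).+1 0; rewrite exprS -[q * _ * _]mulrA expr0 mul1r; apply => //; rewrite eq_sym.
have n4 : th (t * (q * shift m i)) != 0.
  by rewrite -e1; apply: t_shift; rewrite /incn eqxx; have := mM i; lia.
have n5 : th (t * shift m i) != 0 by apply: t_shift; have := mM i; lia.
have n6 : th (q ^+ N.+1) != 0 by apply: genq.
have n7 : \prod_j th (t * z j) != 0.
  apply/prodf_neq0 => j _; have := @t_shift N (fun=> 0%N) j; rewrite /shift expr0 mul1r; apply; lia.
have n8 : \prod_(j | j != i) th (shift m i / shift m j) != 0.
  by apply/prodf_neq0 => j ji; apply: genz; rewrite 1?eq_sym // ltnW.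
have n9 : \prod_(j | j != i) th (t * shift m j) != 0.
  by apply/prodf_neq0 => j ji; apply: t_shift; have := mM j; lia.
move: (\prod_(j | j != i) th (q * shift m i / shift m j)) (\prod_(j | j != i) th (shift m i / shift m j))
  (\prod_j th (q * shift m i / z j)) (\prod_j th (t * z j)) (\prod_(j | j != i) th (t * shift m j))
  (th (b * shift m i)) (th (t * (q * shift m i))) (th (t * shift m i)) (th (q ^+ N.+1)) (\prod_(al <- as_) _)
  n1 n2 n3 n4 n5 n6 n7 n8 n9.
move=> a1 a2 a3 a4 a5 a6 a7 a8 a9 a10 n1 n2 n3 n4 n5 n6 n7 n8 n9.
by field; rewrite n1 n2 n3 n4 n5 n6 n7 n8 n9.
Qed.

Lemma merge_sum N m : (\sum_j m j = N)%N -> (N < M)%N ->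
  \sum_i merge_coef (b * q ^+ N) N m i =
  (\prod_(al <- as_) th (b / al * q ^+ N)) / (th (q ^+ N.+1) * \prod_j th (b * z j * q ^+ N)).
Proof.
move=> mN NM; have mM j : (m j < M)%N.
  by apply: leq_ltn_trans NM; rewrite -mN (bigD1 j) //= leq_addr.
have t0 : b * q ^+ N != 0 by rewrite mulf_neq0 ?expf_neq0 ?b_neq0.
have ys0 : all (fun y => y != 0) (map (@GRing.inv K) as_).
  by rewrite all_map; apply: sub_all as0 => y /=; rewrite invr_eq0.
have n9 : \prod_j th (b * q ^+ N * shift m j) != 0.
  by apply/prodf_neq0 => j _; apply: t_shift; have := mM j; lia.
rewrite /merge_coef -mulr_suml.
have := @partial_fractions_pole _ _ thP n (shift m) (b * q ^+ N) (map (@GRing.inv K) as_) (shift_neq0 m) t0 ys0.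
rewrite size_map size_as !big_map => /(_ erefl) H.
have -> : \sum_i (\prod_(al <- as_) th (al * shift m i)) /
     (\prod_(j | j != i) th (shift m i / shift m j) * th (b * q ^+ N * shift m i)) =
   (\prod_(al <- as_) th (b * q ^+ N / al)) / \prod_j th (b * q ^+ N * shift m j).
  rewrite -H.
  - apply: eq_bigr => i _; rewrite big_map; congr (_ / _); apply: eq_bigr => al _.
    by rewrite invrK mulrC.
  - rewrite prod_shift mN prodfV /b; field; by rewrite prodf_seq_neq0.
  - by move=> i j ij; apply: genz; rewrite // ltnW.
  - by move=> i; apply: t_shift; have := mM i; lia.
rewrite mulrA divfK // ; congr (_ / (_ * _)); first by apply: eq_bigr => al _; rewrite mulrAC.
by apply: eq_bigr => j _; rewrite mulrAC.
Qed.

Lemma vandermonde_z_neq0 : vandermonde th z != 0.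
Proof.
apply/prodf_neq0 => r _; apply/prodf_neq0 => s rs; rewrite mulf_neq0 //.
have := @genz r s 0 0; rewrite !expr0 !mul1r; apply => //.
by rewrite -val_eqE neq_ltn rs.
Qed.

(** Induction on [N]: expand 1 by [split_sum], substitute [k = m + e_i] in the [i]-th
    part, and sum over [i] by [merge_sum]; the result does not depend on [m]. *)
Theorem rosengren_sum N : (N <= M)%N ->
  \sum_(k : {ffun 'I_n -> 'I_M.+1} | (\sum_j k j)%N == N) rosengren_term (fun j => k j) =
  (\prod_(al <- as_) pf (b / al) N) / (pf q N * \prod_j pf (b * z j) N).
Proof.
elim: N => [|N IH] NM.
  rewrite (big_pred1 [ffun=> ord0]) => [|k]; last first.
    rewrite sum_nat_eq0; apply/forallP/eqP => [h|-> j]; last by rewrite ffunE.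
    by apply/ffunP => j; rewrite ffunE; apply: val_inj; apply/eqP; apply: h.
  rewrite pfact0 !big1 ?divr1 => [|j _|al _]; rewrite ?pfact0 //.
  rewrite /rosengren_term big1 ?mulr1 => [|j _].
    rewrite (@vandermonde_ext _ z) => [|j]; first by rewrite divr1 divff ?vandermonde_z_neq0.
    by rewrite /shift ffunE expr0 mul1r.
  rewrite ffunE /rosengren_factor pfact0 big1 => [|al _]; last exact: pfact0.
  by rewrite big1 => [|l _]; rewrite ?pfact0 // !mul1r invr1.
have pS : (\prod_(al <- as_) pf (b / al) N.+1) / (pf q N.+1 * \prod_j pf (b * z j) N.+1) =
   (\prod_(al <- as_) pf (b / al) N) / (pf q N * \prod_j pf (b * z j) N) *
   ((\prod_(al <- as_) th (b / al * q ^+ N)) / (th (q ^+ N.+1) * \prod_j th (b * z j * q ^+ N))).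
  under eq_bigr do rewrite pfactS; under [in X in _ / X]eq_bigr do rewrite pfactS.
  by rewrite !big_split /= pfactS -exprS !invfM; ring.
rewrite pS -(IH (ltnW NM)) mulr_suml.
transitivity (\sum_(m : {ffun 'I_n -> 'I_M.+1} | (\sum_j m j)%N == N)
   \sum_i rosengren_term (fun j => m j) * merge_coef (b * q ^+ N) N (fun j => m j) i); last first.
  by apply: eq_bigr => m /eqP mN; rewrite -mulr_sumr merge_sum.
pose G (k : {ffun 'I_n -> 'I_M.+1}) i := rosengren_term (fun j => k j) *
   (split_coef (b * q ^+ N) (fun j => k j) i / split_total (b * q ^+ N) (fun j => k j)).
transitivity (\sum_(k : {ffun 'I_n -> 'I_M.+1} | (\sum_j k j)%N == N.+1) \sum_i G k i).
  apply: eq_bigr => k /eqP kN; rewrite -mulr_sumr -mulr_suml split_sum // divff ?mulr1 //.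
  exact: split_total_neq0.
rewrite exchange_big [RHS]exchange_big; apply: eq_bigr => i _.
rewrite (bigID (fun k : {ffun 'I_n -> 'I_M.+1} => (0 < k i)%N)) /= [X in _ + X]big1 => [|k /andP[_ ki]].
  rewrite addr0 sum_incf_reindex //; apply: eq_bigr => m /eqP mN.
  have h : (m i < M)%N by apply: leq_ltn_trans NM; rewrite -mN (bigD1 i) //= leq_addr.
  rewrite -split_term_inc // /G.
  by have -> : (fun j => incf i m j : nat) = incn i (fun j => m j) by apply/boolp.funext => j; rewrite incfE.
rewrite /G /split_coef; have -> : \prod_j th (shift (fun j => k j) i / z j) = 0.
  rewrite (bigD1 i) //= /shift; move: ki; rewrite -leqNgt leqn0 => /eqP ->.
  by rewrite expr0 mul1r divff // (th_one thP) mul0r.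
by rewrite mulr0 !mul0r mulr0.
Qed.

End RosengrenSum.

(** * The Frenkel-Turaev sum *)
Section FrenkelTuraev.
Variables (K : fieldType) (th : K -> K) (q : K).
Hypotheses (thP : theta_like th) (q0 : q != 0).
Local Notation pf := (pfact th q).

(** The parameters [e, f, u, v] stand for [a^2 q^(N+1) / (b c d)], [a q / e], [q^(-N)] and
    [a q / u]; keeping them free shows which of them are shifted in the recurrence. *)
Definition ft_summand a b c d e f u v k :=
  th (a * q ^+ (2 * k)) / th a * (pf a k * pf b k * pf c k * pf d k * pf e k * pf u k) /
  (pf q k * pf (a * q / b) k * pf (a * q / c) k * pf (a * q / d) k * pf f k * pf v k) * q ^+ k.

Definition ft_term N a b c d :=
  ft_summand a b c d (a ^+ 2 * q ^+ N.+1 / (b * c * d)) (b * c * d / (a * q ^+ N))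
    (q ^+ N)^-1 (a * q ^+ N.+1).

Definition ft_rhs N a b c d :=
  pf (a * q) N * pf (a * q / (b * c)) N * pf (a * q / (b * d)) N * pf (a * q / (c * d)) N /
  (pf (a * q / b) N * pf (a * q / c) N * pf (a * q / d) N * pf (a * q / (b * c * d)) N).

(** The coefficient of the shifted sum in the recurrence, the same for the summands and for
    the right hand sides. *)
Definition ft_kappa N a b c d :=
  let e := a ^+ 2 * q ^+ N.+2 / (b * c * d) in let f := b * c * d / (a * q ^+ N.+1) in
  let v := a * q ^+ N.+2 in
  f * q * th (e * q ^+ N) * th (e / v) / (th f * th (f * q) * th (v / q) * th v) *
  (th (a * q) * th (a * q ^+ 2) * th b * th c * th d) / (th (a * q / b) * th (a * q / c) * th (a * q / d)).

(** The theta values that occur in denominators at some stage of the induction on [N]; the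
    ranges are such that the condition passes to both sums of level [N - 1]. *)
Definition ft_generic N a b c d :=
  [/\ forall i, (i <= 2 * N)%N -> th (a * q ^+ i) != 0,
      forall i, (0 < i <= N)%N -> th (q ^+ i) != 0,
      forall i, (0 < i <= N)%N -> [/\ th (a * q ^+ i / b) != 0, th (a * q ^+ i / c) != 0 & th (a * q ^+ i / d) != 0] &
      forall i, (i <= 2 * N)%N -> th (b * c * d * q ^+ i / (a * q ^+ N)) != 0].

(** Up to common factors the first two summands are the two products on the left of the
    three-term relation at the points [q^(j+1), 1, e / (a q), 1 / u], and the third summand
    is the product on its right. *)
Lemma ft_summand_step a b c d e f u v j :
  a != 0 -> b != 0 -> c != 0 -> d != 0 -> e != 0 -> f = a * q / e -> u != 0 -> v = a * q / u ->
  th (a * q ^+ j.+1) != 0 -> th a != 0 -> th (a * q ^+ 2) != 0 -> th (q ^+ j.+1) != 0 -> th (a * q) != 0 ->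
  th (f * q ^+ j.+1) != 0 -> th f != 0 -> th (f * q) != 0 ->
  th (v * q ^+ j) != 0 -> th (v / q) != 0 -> th v != 0 ->
  ft_summand a b c d e f u v j.+1 =
  ft_summand a b c d (e / q) (f * q) (u * q) (v / q) j.+1 +
  f * q * th (e / (u * q)) * th (e / v) / (th f * th (f * q) * th (v / q) * th v) *
  (th (a * q) * th (a * q ^+ 2) * th b * th c * th d) / (th (a * q / b) * th (a * q / c) * th (a * q / d)) *
  ft_summand (a * q ^+ 2) (b * q) (c * q) (d * q) e (f * q ^+ 2) (u * q) (v * q) j.
Proof.
move=> a0 b0 c0 d0 e0 fE u0 vE n1 n2 n3 n4 n5 n6 n7 n8 n9 n10 n11.
have two x (y := pf (x * q ^+ 2) j) : th (x * q ^+ j.+1) != 0 -> pf x j.+1 = th x * th (x * q) * y / th (x * q ^+ j.+1).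
  move=> h; apply: (mulIf h); rewrite divfK // -pfactS 2!pfactSl mulrA /y.
  by rewrite expr2 mulrA.
have qq : q ^+ j.+1 != 0 by rewrite expf_neq0.
have three : th (e * q ^+ j) * th (f * q ^+ j.+1) * th u * th (v / q) -
    th (e / q) * th f * th (u * q ^+ j.+1) * th (v * q ^+ j) =
    f * th (a * q ^+ j.+1) * th (q ^+ j.+1) * th (e / (u * q)) * th (e / v).
  have Y0 : e / (a * q) != 0 by rewrite mulf_neq0 ?invr_eq0 ?mulf_neq0.
  have uV0 : u^-1 != 0 by rewrite invr_eq0.
  have := th_three_term thP a0 qq (oner_neq0 _) Y0 uV0.
  rewrite /= !mulr1 !invrK mul1r div1r.
  have -> : a * q ^+ j.+1 * (e / (a * q)) = e * q ^+ j by rewrite exprS; field; rewrite ?a0 ?q0 ?e0 ?u0.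
  have -> : q ^+ j.+1 / (e / (a * q)) = f * q ^+ j.+1 by rewrite fE; field; rewrite ?a0 ?q0 ?e0 ?u0.
  have -> : a / u = v / q by rewrite vE; field; rewrite ?a0 ?q0 ?e0 ?u0.
  have -> : a * q ^+ j.+1 / u = v * q ^+ j by rewrite vE exprS; field; rewrite ?a0 ?q0 ?e0 ?u0.
  have -> : a * (e / (a * q)) = e / q by field; rewrite ?a0 ?q0 ?e0 ?u0.
  have -> : (e / (a * q))^-1 = f by rewrite invf_div fE.
  have -> : q ^+ j.+1 * u = u * q ^+ j.+1 by rewrite mulrC.
  have -> : e / q / u = e / (u * q) by field; rewrite ?a0 ?q0 ?e0 ?u0.
  have -> : e / (a * q) * u = e / v by rewrite vE; field; rewrite ?a0 ?q0 ?e0 ?u0.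
  have -> : e / (a * q) = f^-1 by rewrite fE invf_div.
  rewrite divr1 mul1r.
  have f0 : f != 0 by rewrite fE !mulf_neq0 ?invr_eq0.
  move=> H; transitivity (f * (th (a * q ^+ j.+1) * th (q ^+ j.+1) * (th (e / (u * q)) * th (e / v)))); last by ring.
  by rewrite -H mulVKf //; ring.
have e2 : a * q ^+ 2 * q ^+ (2 * j) = a * q ^+ (2 * j.+1) by rewrite -mulrA -exprD mulnS.
have sh x : x != 0 -> a * q / x * q = a * q ^+ 2 * q / (x * q) by move=> x0; field; rewrite q0 x0.
have eb x : x != 0 -> pf (a * q / x) j.+1 = th (a * q / x) * pf (a * q ^+ 2 * q / (x * q)) j.
  by move=> x0; rewrite pfactSl sh.
have ef : pf (f * q) j.+1 = th (f * q) * pf (f * q ^+ 2) j by rewrite pfactSl expr2 mulrA.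
have ee : pf (e / q) j.+1 = th (e / q) * pf e j by rewrite pfactSl divfK.
have ev : pf (v / q) j.+1 = th (v / q) * th v * pf (v * q) j / th (v * q ^+ j).
  apply: (mulIf n9); rewrite divfK // pfactSl divfK // -[LHS]mulrA -[RHS]mulrA.
  by rewrite -pfactS pfactSl.
rewrite /ft_summand e2 ef ee ev (two a n1) (two f n6) !eb // (pfactSl _ _ b) (pfactSl _ _ c) (pfactSl _ _ d).
rewrite (pfactSl _ _ u) (pfactSl _ _ v) (pfactS _ _ e) (pfactS _ _ q) (pfactS _ _ (u * q)).
rewrite -[u * q * q ^+ j]mulrA -!exprS.
have qj : q ^+ j.+1 = q * q ^+ j by rewrite exprS.
move: three n1 n2 n3 n4 n6 n7 n8 n9 n10 n11.
move: (pf (a * q ^+ 2 * q / (b * q)) j) (pf (a * q ^+ 2 * q / (c * q)) j)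
  (pf (a * q ^+ 2 * q / (d * q)) j) (th (a * q / b)) (th (a * q / c)) (th (a * q / d))
  => AB' AC' AD' ab' ac' ad'.
move: (th (e * q ^+ j)) (th (f * q ^+ j.+1)) (th u) (th (v / q)) (th (e / q)) (th f)
  (th (u * q ^+ j.+1)) (th (v * q ^+ j)) (th (a * q ^+ j.+1)) (th (q ^+ j.+1)) (th (e / (u * q))) (th (e / v))
  => x1 x2 x3 x4 y1 y2 y3 y4 g1 g2 g3 g4 three.
move: (th (a * q ^+ (2 * j.+1))) (th a) (th (a * q)) (th (a * q ^+ 2)) (th b) (th c) (th d) (th (f * q)) (th v)
  => t2 ta taq taq2 tb tc td tfq tv n1 n2 n3 n4 n6 n7 n8 n9 n10 n11.
move: (pf q j) (pf (f * q ^+ 2) j) (pf (v * q) j) => Q' F' V'.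
move: (pf _ _) (pf _ _) (pf _ _) (pf _ _) (pf _ _) (pf _ _) => A B C D E U.
rewrite !invfM !invrK.
move: Q'^-1 AB'^-1 AC'^-1 AD'^-1 F'^-1 V'^-1 ab'^-1 ac'^-1 ad'^-1 => Q AB AC AD F V ab ac ad.
rewrite qj; apply/eqP; rewrite -subr_eq0; apply/eqP.
pose W := t2 * taq * A * tb * B * tc * C * td * D * E * U * Q * ab * AB * ac * AC * ad * AD * F * V * q * q ^+ j /
  (g1 * g2 * y2 * tfq * tv * x4).
transitivity (W * (x1 * x2 * x3 * x4 - y1 * y2 * y3 * y4 - f * g1 * g2 * g3 * g4)).
  rewrite /W; field; by rewrite ?n1 ?n2 ?n3 ?n4 ?n7 ?n8 ?n10 ?n11.
by rewrite three subrr mulr0.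
Qed.

(** The three-term relation with scale [A^2 / (b c d^2)] at the points
    [d, 1, b c d / A, c d / A]. *)
Lemma ft_key A b c d : A != 0 -> b != 0 -> c != 0 -> d != 0 ->
  th A * th (A / (b * c)) * th (A / (b * d)) * th (A / (c * d)) =
  th (A / b) * th (A / c) * th (A / d) * th (A / (b * c * d)) +
  A / (b * c * d) * (th b * th c * th d * th (A ^+ 2 / (b * c * d))).
Proof.
move=> A0 b0 c0 d0.
have al0 : A ^+ 2 / (b * c * d ^+ 2) != 0 by rewrite mulf_neq0 ?expf_neq0 // invr_eq0 !mulf_neq0 ?expf_neq0.
have U0 : b * c * d / A != 0 by rewrite !mulf_neq0 ?invr_eq0.
have V0 : c * d / A != 0 by rewrite !mulf_neq0 ?invr_eq0.
have := th_three_term thP al0 d0 (oner_neq0 _) U0 V0.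
rewrite /= !mulr1 !mul1r divr1.
have -> : A ^+ 2 / (b * c * d ^+ 2) * d * (b * c * d / A) = A by field; rewrite ?A0 ?b0 ?c0 ?d0.
have -> : d / (b * c * d / A) = A / (b * c) by field; rewrite ?A0 ?b0 ?c0 ?d0.
have -> : A ^+ 2 / (b * c * d ^+ 2) * (c * d / A) = A / (b * d) by field; rewrite ?A0 ?b0 ?c0 ?d0.
have -> : A ^+ 2 / (b * c * d ^+ 2) * d * (c * d / A) = A / b by field; rewrite ?A0 ?b0 ?c0 ?d0.
have -> : d / (c * d / A) = A / c by field; rewrite A0 c0 d0.
have -> : A ^+ 2 / (b * c * d ^+ 2) * (b * c * d / A) = A / d by field; rewrite ?A0 ?b0 ?c0 ?d0.
have -> : A ^+ 2 / (b * c * d ^+ 2) * d = A ^+ 2 / (b * c * d) by field; rewrite ?A0 ?b0 ?c0 ?d0.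
have -> : A / d * (c * d / A) = c by field; rewrite ?A0 ?b0 ?c0 ?d0.
have -> : b * c * d / A / (c * d / A) = b by field; rewrite ?A0 ?b0 ?c0 ?d0.
have -> : (c * d / A)^-1 = A / (c * d) by rewrite invf_div.
have -> : (b * c * d / A)^-1 = A / (b * c * d) by rewrite invf_div.
move=> H; have -> : th b * th c * th d * th (A ^+ 2 / (b * c * d)) =
    th (A ^+ 2 / (b * c * d)) * th d * (th c * th b) by ring.
rewrite -H; move: (th _) (th _) (th _) (th _) (th _) (th _) (th _) (th _) => *.
by field; rewrite ?A0 ?b0 ?c0 ?d0.
Qed.

Lemma ft_rhs_step N a b c d : a != 0 -> b != 0 -> c != 0 -> d != 0 ->
  ft_generic N.+1 a b c d ->
  ft_rhs N.+1 a b c d = ft_rhs N a b c d +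
    ft_kappa N a b c d * ft_rhs N (a * q ^+ 2) (b * q) (c * q) (d * q).
Proof.
have [i1 i2 i3 i4 i5] : [/\ (N.+1 <= 2 * N.+1)%N, (N.+2 <= 2 * N.+1)%N, (1 <= 2 * N.+1)%N, (2 <= 2 * N.+1)%N & (0 <= 2 * N.+1)%N] by split; lia.
move=> a0 b0 c0 d0 [ga gq gb ge].
have qN : q ^+ N != 0 by rewrite expf_neq0.
pose A := a * q ^+ N.+1; pose g := a / (b * c * d).
have A0 : A != 0 by rewrite mulf_neq0 ?expf_neq0.
have g0 : g != 0 by rewrite mulf_neq0 ?invr_eq0 ?mulf_neq0.
have thA : th A != 0 by apply: ga.
have thv : th (a * q ^+ N.+2) != 0 by apply: ga.
have thaq : th (a * q) != 0 by have := ga 1%N i3; rewrite expr1.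
have thaq2 : th (a * q ^+ 2) != 0 by apply: ga.
have [tab tac tad] : [/\ th (a * q / b) != 0, th (a * q / c) != 0 & th (a * q / d) != 0].
  by have := gb 1%N isT; rewrite expr1.
have [tAb tAc tAd] : [/\ th (A / b) != 0, th (A / c) != 0 & th (A / d) != 0].
  by apply: gb; rewrite leqnn.
have tg : th g != 0.
  have -> : g = (b * c * d * q ^+ N.+1 / (a * q ^+ N.+1))^-1 by rewrite /g; field; rewrite a0 b0 c0 d0 expf_neq0.
  by apply: (th_inv_neq0 thP); [rewrite !mulf_neq0 ?invr_eq0 ?mulf_neq0 ?expf_neq0|exact: ge].
have tgN : th (g * q ^+ N) != 0.
  have -> : g * q ^+ N = (b * c * d * q ^+ 1 / (a * q ^+ N.+1))^-1.
    by rewrite /g [q ^+ N.+1]exprS expr1; field; rewrite a0 b0 c0 d0 q0 qN.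
  by apply: (th_inv_neq0 thP); [rewrite !mulf_neq0 ?invr_eq0 ?mulf_neq0 ?expf_neq0|exact: ge].
have tgN1 : th (A / (b * c * d)) != 0.
  have -> : A / (b * c * d) = (b * c * d * q ^+ 0 / (a * q ^+ N.+1))^-1.
    by rewrite /A expr0; field; rewrite a0 b0 c0 d0 expf_neq0.
  by apply: (th_inv_neq0 thP); [rewrite !mulf_neq0 ?invr_eq0 ?mulf_neq0 ?expf_neq0|exact: ge].
have sh x : a * q / x * q ^+ N = A / x by rewrite /A exprS; ring.
have shA : a * q * q ^+ N = A by rewrite /A exprS; ring.
have r1 : pf (a * q ^+ 2 * q) N = pf (a * q) N * th A * th (a * q ^+ N.+2) / (th (a * q) * th (a * q ^+ 2)).
  have h : th (a * q) * th (a * q ^+ 2) != 0 by rewrite mulf_neq0.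
  apply: (mulIf h); rewrite divfK // -[in RHS]shA -pfactS.
  have -> : a * q ^+ N.+2 = a * q * q ^+ N.+1 by rewrite -mulrA -exprS.
  by rewrite -pfactS 2!pfactSl -!mulrA -expr2; ring.
have r3 x : x != 0 -> th (a * q / x) != 0 ->
    pf (a * q ^+ 2 * q / (x * q)) N = pf (a * q / x) N * th (A / x) / th (a * q / x).
  move=> x0 h; apply: (mulIf h); rewrite divfK // -sh -pfactS pfactSl mulrC.
  by congr (_ * pf _ _); field; rewrite x0 q0.
have r2 x y : x != 0 -> y != 0 -> a * q ^+ 2 * q / (x * q * (y * q)) = a * q / (x * y).
  by move=> x0 y0; field; rewrite x0 y0 q0.
have r4 : pf (a * q ^+ 2 * q / (b * q * (c * q) * (d * q))) N =
    th g * pf (a * q / (b * c * d)) N / th (g * q ^+ N).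
  have -> : a * q ^+ 2 * q / (b * q * (c * q) * (d * q)) = g by rewrite /g; field; rewrite b0 c0 d0 q0.
  have -> : a * q / (b * c * d) = g * q by rewrite /g; ring.
  by apply: (mulIf tgN); rewrite divfK // -pfactS pfactSl.
have k1 : b * c * d / (a * q ^+ N.+1) = (A / (b * c * d))^-1 by rewrite invf_div.
have k2 : (A / (b * c * d))^-1 * q = (g * q ^+ N)^-1.
  by rewrite /A /g exprS; field; rewrite a0 b0 c0 d0 q0 qN.
have k3 : a ^+ 2 * q ^+ N.+2 / (b * c * d) * q ^+ N = A ^+ 2 / (b * c * d).
  by rewrite /A !exprS; ring.
have k4 : a ^+ 2 * q ^+ N.+2 / (b * c * d) / (a * q ^+ N.+2) = g.
  by rewrite /g; field; rewrite a0 b0 c0 d0 expf_neq0.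
have k5 : a * q ^+ N.+2 / q = A by rewrite /A [q ^+ N.+2]exprS; field.
rewrite /ft_kappa /ft_rhs k1 k2 k3 k4 k5 r4 r1 !r3 // !r2 // !pfactS !sh shA.
rewrite !(th_inv thP) ?mulf_neq0 ?invr_eq0 ?mulf_neq0 ?expf_neq0 //.
have key := ft_key A0 b0 c0 d0.
have gqN0 : g * q ^+ N != 0 by rewrite mulf_neq0.
have x0 : A / (b * c * d) != 0 by apply: mulf_neq0 => //; rewrite invr_eq0 !mulf_neq0.
move: key tAb tAc tAd thA thv thaq thaq2 tab tac tad tg tgN tgN1 gqN0 x0.
move: (pf (a * q) N) (pf (a * q / (b * c)) N) (pf (a * q / (b * d)) N) (pf (a * q / (c * d)) N)
 (pf (a * q / b) N) (pf (a * q / c) N) (pf (a * q / d) N) (pf (a * q / (b * c * d)) N)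
 => P1 P2 P3 P4 Q1' Q2' Q3' Q4'.
move: (th (A / (b * c))) (th (A / (b * d))) (th (A / (c * d))) (th (A / b)) (th (A / c)) (th (A / d))
  (th (A / (b * c * d))) (th b) (th c) (th d) (th (A ^+ 2 / (b * c * d))) (th A) => y1 y2 y3 y4' y5' y6' y7 y8 y9 y10 y11 y12.
move: (th (a * q ^+ N.+2)) (th (a * q)) (th (a * q ^+ 2)) (th (a * q / b)) (th (a * q / c)) (th (a * q / d)) (th g)
  (th (g * q ^+ N)) => u1 u2 u3 u4 u5 u6 u7 u8.
move: (g * q ^+ N) (A / (b * c * d)) => v w key m1 m2 m3 n1 n2 n3 n4 n5 n6 n7 n8 n9 n10 n11 n12.
rewrite !invfM !invrK; move: Q1'^-1 Q2'^-1 Q3'^-1 Q4'^-1 => Q1 Q2 Q3 Q4.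
apply/eqP; rewrite -subr_eq0; apply/eqP.
transitivity (P1 * P2 * P3 * P4 * Q1 * Q2 * Q3 * Q4 / (y4' * y5' * y6' * y7) *
   (y12 * y1 * y2 * y3 - (y4' * y5' * y6' * y7 + w * (y8 * y9 * y10 * y11)))); last first.
  by rewrite key subrr mulr0.
by field; rewrite ?oppr_eq0 m1 m2 m3 ?n1 ?n2 ?n3 ?n4 ?n5 ?n6 ?n7 ?n8 ?n9 ?n10 ?n11 ?n12.
Qed.

Lemma pfact_vanish N j : (N < j)%N -> pf (q ^+ N)^-1 j = 0.
Proof.
move=> h; apply/eqP; rewrite prodf_seq_eq0; apply/hasP; exists N.
  by rewrite mem_index_iota.
by rewrite /= mulVf ?expf_neq0 // (th_one thP) eqxx.
Qed.

Lemma ft_term0 N a b c d : th a != 0 -> ft_term N a b c d 0 = 1.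
Proof. by move=> h; rewrite /ft_term /ft_summand !pfact0 muln0 expr0 !mulr1 divff // invr1 mulr1. Qed.

Lemma ft_term_step N a b c d j : a != 0 -> b != 0 -> c != 0 -> d != 0 ->
  ft_generic N.+1 a b c d -> (j <= N)%N ->
  ft_term N.+1 a b c d j.+1 = ft_term N a b c d j.+1 +
    ft_kappa N a b c d * ft_term N (a * q ^+ 2) (b * q) (c * q) (d * q) j.
Proof.
have [i1 i2 i3 i4 i5] : [/\ (N.+1 <= 2 * N.+1)%N, (N.+2 <= 2 * N.+1)%N, (1 <= 2 * N.+1)%N, (2 <= 2 * N.+1)%N & (0 <= 2 * N.+1)%N] by split; lia.
move=> a0 b0 c0 d0 [ga gq gb ge] jN.
have [i6 i7 i8] : [/\ (j.+1 <= 2 * N.+1)%N, (N.+2 + j <= 2 * N.+1)%N & (0 < j.+1 <= N.+1)%N].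
  by move: jN; clear; split; lia.
have qN k : q ^+ k != 0 by rewrite expf_neq0.
pose e := a ^+ 2 * q ^+ N.+2 / (b * c * d); pose f := b * c * d / (a * q ^+ N.+1).
pose u := (q ^+ N.+1)^-1; pose v := a * q ^+ N.+2.
have e0 : e != 0 by apply: mulf_neq0; [apply: mulf_neq0; exact: expf_neq0 | rewrite invr_eq0 !mulf_neq0].
have u0 : u != 0 by rewrite invr_eq0.
have fE : f = a * q / e by rewrite /f /e !exprS; field; rewrite a0 b0 c0 d0 q0 qN.
have vE : v = a * q / u by rewrite /v /u invrK [q ^+ N.+2]exprS mulrA.
have fq i : f * q ^+ i = b * c * d * q ^+ i / (a * q ^+ N.+1) by rewrite /f mulrAC.
have E1 : e / q = a ^+ 2 * q ^+ N.+1 / (b * c * d) by rewrite /e [q ^+ N.+2]exprS; field; rewrite b0 c0 d0 q0.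
have E2 : f * q = b * c * d / (a * q ^+ N) by rewrite /f exprS; field; rewrite a0 q0 qN.
have E3 : u * q = (q ^+ N)^-1 by rewrite /u exprS; field; rewrite q0 qN.
have E4 : v / q = a * q ^+ N.+1 by rewrite /v [q ^+ N.+2]exprS; field.
have E5 : (a * q ^+ 2) ^+ 2 * q ^+ N.+1 / (b * q * (c * q) * (d * q)) = e.
  by rewrite /e [q ^+ N.+2]exprS; field; rewrite b0 c0 d0 q0.
have E6 : b * q * (c * q) * (d * q) / (a * q ^+ 2 * q ^+ N) = f * q ^+ 2.
  by rewrite /f [q ^+ N.+1]exprS; field; rewrite a0 q0 qN.
have E7 : a * q ^+ 2 * q ^+ N.+1 = v * q by rewrite /v [q ^+ N.+2]exprS; ring.
have E8 : e * q ^+ N = e / (u * q) by rewrite E3 invrK.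
rewrite /ft_term /ft_kappa E5 E6 E7 -/e -/f -/u -/v -E1 -E2 -E3 -E4 E8.
apply: ft_summand_step => //.
- exact: ga.
- by have := ga 0%N i5; rewrite expr0 mulr1.
- exact: ga.
- exact: gq.
- by have := ga 1%N i3; rewrite expr1.
- by rewrite fq; exact: ge.
- by have := ge 0%N i5; rewrite expr0 mulr1.
- by rewrite -[q]expr1 fq; exact: ge.
- by rewrite /v -mulrA -exprD; exact: ga.
- by rewrite E4; exact: ga.
- exact: ga.
Qed.

Lemma ft_generic_pred N a b c d : ft_generic N.+1 a b c d -> ft_generic N a b c d.
Proof.
have h1 i : (i <= 2 * N)%N -> (i.+1 <= 2 * N.+1)%N by lia.
have h2 i : (0 < i <= N)%N -> (0 < i <= N.+1)%N by lia.
case=> ga gq gb ge; split=> i hi.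
- by apply: ga; apply: leq_trans (h1 _ hi).
- by apply: gq; apply: h2.
- by apply: gb; apply: h2.
have := ge _ (h1 _ hi); rewrite [q ^+ i.+1]exprS [q ^+ N.+1]exprS.
by congr (th _ != 0); rewrite !invfM; move: a^-1 (q ^+ N)^-1 => aV QV; field.
Qed.

Lemma ft_generic_shift N a b c d : ft_generic N.+1 a b c d ->
  ft_generic N (a * q ^+ 2) (b * q) (c * q) (d * q).
Proof.
have h1 i : (i <= 2 * N)%N -> (i.+2 <= 2 * N.+1)%N by lia.
have h2 i : (0 < i <= N)%N -> (0 < i <= N.+1)%N by lia.
have h3 i : (0 < i <= N)%N -> (0 < i.+1 <= N.+1)%N by lia.
case=> ga gq gb ge; split=> i hi.
- by rewrite -mulrA -exprD; apply: ga; apply: h1.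
- by apply: gq; apply: h2.
- have := gb _ (h3 _ hi).
  have e y : a * q ^+ 2 * q ^+ i / (y * q) = a * q ^+ i.+1 / y.
    by rewrite [q ^+ i.+1]exprS invfM; move: y^-1 => yV; field.
  by rewrite !e.
have := ge _ (h1 _ hi).
by congr (th _ != 0); rewrite [q ^+ i.+2]exprS [q ^+ i.+1]exprS [q ^+ N.+1]exprS !invfM; move: a^-1 (q ^+ N)^-1 => aV QV; field.
Qed.

Theorem frenkel_turaev_sum N a b c d : a != 0 -> b != 0 -> c != 0 -> d != 0 ->
  ft_generic N a b c d ->
  \sum_(0 <= k < N.+1) ft_term N a b c d k = ft_rhs N a b c d.
Proof.
elim: N a b c d => [|N IH] a b c d a0 b0 c0 d0 gen.
  rewrite big_nat1 ft_term0; first by rewrite /ft_rhs !pfact0 !mulr1 divr1.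
  by case: gen => ga _ _ _; have := ga 0%N isT; rewrite expr0 mulr1.
have ta : th a != 0 by case: gen => ga _ _ _; have := ga 0%N isT; rewrite expr0 mulr1.
rewrite ft_rhs_step // -(IH a b c d) //; last exact: ft_generic_pred.
rewrite -(IH (a * q ^+ 2)) ?mulf_neq0 ?expf_neq0 //; last exact: ft_generic_shift.
rewrite big_nat_recl // ft_term0 // -{1}(ft_term0 N b c d ta).
rewrite (eq_big_nat _ _ (F2 := fun j => ft_term N a b c d j.+1 +
    ft_kappa N a b c d * ft_term N (a * q ^+ 2) (b * q) (c * q) (d * q) j)); last first.
  by move=> j /andP[_ jN]; apply: ft_term_step.
rewrite big_split /= -mulr_sumr addrA; congr (_ + _).
rewrite -big_nat_recl // big_nat_recr //= [X in _ + X](_ : _ = 0) ?addr0 //.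
by rewrite /ft_term /ft_summand pfact_vanish // !(mulr0, mul0r).
Qed.

End FrenkelTuraev.

(** * The multiple sum for generic parameters *)
Section GenericSum.
Variables (K : fieldType) (th : K -> K) (q : K) (n : nat) (N : 'I_n -> nat).
Variables (a b c d e : K) (x : 'I_n -> K).
Local Notation pf := (pfact th q).
Local Notation M := (\sum_(r < n) N r)%N.

Definition pfacts (s : seq K) k := \prod_(y <- s) pf y k.

Definition vander_part (k : 'I_n -> nat) :=
  \prod_(r < n) \prod_(s < n | (r < s)%N)
        (th (q ^ ((k r)%:Z - (k s)%:Z) * x r / x s) / th (x r / x s)).
Definition box_part (k : 'I_n -> nat) :=
  \prod_(r < n) \prod_(s < n) (pf (q ^- N s * x r / x s) (k r) / pf (q * x r / x s) (k r)).
Definition weight_part (w : nat) :=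
  (th (a * q ^+ (2 * w)) / th a) *
  (pfacts [:: a; b; c; d; a ^+ 2 * q ^+ (1 + M) / (b * c * d)] w
        / pfacts [:: a * q ^+ M.+1; a * q / b; a * q / c; a * q / d;
                      b * c * d * q ^- M / a] w).
Definition e_part (k : 'I_n -> nat) (w : nat) :=
  \prod_(r < n) ((pf (e * x r * q ^+ M) (k r) * pf (e * x r) w)
         / (pf (e * x r) (k r) * pf (e * x r * q ^+ N r) w)).

Definition sum_term (k : 'I_n -> nat) :=
  let w := (\sum_(r < n) k r)%N in
  vander_part k * box_part k * (th (a * q ^+ (2 * w)) / th a) *
  (pfacts [:: a; b; c; d; a ^+ 2 * q ^+ (1 + M) / (b * c * d)] w
        / pfacts [:: a * q ^+ M.+1; a * q / b; a * q / c; a * q / d;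
                      b * c * d * q ^- M / a] w) *
  e_part k w * q ^+ (\sum_(r < n) r.+1 * k r)%N.

Definition sum_rhs :=
  pfacts [:: a * q; a * q / (b * c); a * q / (b * d); a * q / (c * d)] M
    / pfacts [:: a * q / b; a * q / c; a * q / d; a * q / (b * c * d)] M.

Hypotheses (thP : theta_like th) (q0 : q != 0).
Hypotheses (a0 : a != 0) (b0 : b != 0) (c0 : c != 0) (d0 : d != 0) (e0 : e != 0).
Hypothesis x0 : forall r, x r != 0.
Hypothesis genx : forall r s i j, r != s -> (i <= M)%N -> (j <= M)%N ->
  th (q ^+ i * x r / (q ^+ j * x s)) != 0.
Hypothesis gene : forall i r, (i <= 2 * M)%N -> th (e * x r * q ^+ i) != 0.
Hypothesis gena : ft_generic th q M a b c d.

Let as_ := e * q ^+ M :: [seq q ^- N s / x s | s <- index_enum 'I_n].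

Lemma genq i : (0 < i <= M)%N -> th (q ^+ i) != 0.
Proof. by case: gena => _ gq _ _; exact: gq. Qed.

Lemma prod_asE : \prod_(al <- as_) al * \prod_r x r = e.
Proof.
have X0 : \prod_r x r != 0 by apply/prodf_neq0.
rewrite big_cons big_map big_split /= !prodfV -expr_sum.
by field; rewrite X0 expf_neq0.
Qed.

Lemma as_neq0 : all (fun al => al != 0) as_.
Proof.
rewrite /= mulf_neq0 ?expf_neq0 //=; apply/allP => y /mapP[s _ ->].
by rewrite mulf_neq0 ?invr_eq0 ?expf_neq0.
Qed.

Lemma size_as : size as_ = n.+1.
Proof. by rewrite /= size_map -sum1_size big_const_ord iter_addn mul1n addn0. Qed.

(** By the inversion formula, each pair [r < s] contributes [q^(k_s)], and [k_s] is counted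
    [s] times; the remaining [q^|k|] goes with the sum over [|k|]. *)
Lemma vander_partE k :
  vander_part k * q ^+ (\sum_(r < n) r.+1 * k r)%N =
  vandermonde th (shift q x k) / vandermonde th x * q ^+ (\sum_(r < n) k r)%N.
Proof.
have -> : vandermonde th (shift q x k) / vandermonde th x =
  vander_part k * \prod_(r < n) \prod_(s < n | (r < s)%N) q ^+ k s.
  rewrite /vander_part /vandermonde -prodf_div -big_split; apply: eq_bigr => r _ /=.
  rewrite -prodf_div -big_split; apply: eq_bigr => s rs /=.
  have -> : shift q x k r / shift q x k s = q ^ ((k r)%:Z - (k s)%:Z) * x r / x s.
    rewrite /shift expfzDr // -exprnN -exprnP invfM; ring.
  rewrite /shift; move: (th _) (th _) => t t'; rewrite invfM.
  by move: t^-1 => tV; field; rewrite x0.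
rewrite -[RHS]mulrA; congr (_ * _).
have -> : (\sum_(r < n) r.+1 * k r = \sum_(r < n) r * k r + \sum_(r < n) k r)%N.
  by rewrite -big_split; apply: eq_bigr => r _ /=; rewrite mulSn addnC.
rewrite exprD; congr (_ * _).
have -> : \prod_(r < n) \prod_(s < n | (r < s)%N) q ^+ k s = \prod_(s < n) \prod_(r < n | (r < s)%N) q ^+ k s.
  by rewrite (exchange_big_dep xpredT).
rewrite expr_sum; apply: eq_bigr => s _.
rewrite -(big_ord_widen n (fun=> q ^+ k s) (ltnW (ltn_ord s))).
by rewrite prodr_const card_ord mulnC exprM.
Qed.

Lemma sum_termE k (w := (\sum_(r < n) k r)%N) : (w <= M)%N ->
  sum_term k = rosengren_term th q x as_ k *
    (q ^+ w * weight_part w * \prod_(r < n) (pf (e * x r) w / pf (e * x r * q ^+ N r) w)).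
Proof.
move=> wM; have kM r : (k r <= M)%N.
  by apply: leq_trans wM; rewrite /w (bigD1 r) //= leq_addr.
rewrite /sum_term /rosengren_term -/w -/(weight_part w).
have -> : \prod_i rosengren_factor th q x as_ i (k i) =
   box_part k * \prod_(r < n) (pf (e * x r * q ^+ M) (k r) / pf (e * x r) (k r)).
  rewrite /box_part -big_split; apply: eq_bigr => r _ /=.
  rewrite /rosengren_factor prod_asE big_cons big_map prodf_div.
  have -> : e * q ^+ M * x r = e * x r * q ^+ M by rewrite mulrAC.
  have -> : \prod_(j < n) pf (q ^- N j / x j * x r) (k r) = \prod_(s < n) pf (q ^- N s * x r / x s) (k r).
    by apply: eq_bigr => s _; rewrite mulrAC.
  by rewrite invfM; ring.
have -> : e_part k w = \prod_(r < n) (pf (e * x r * q ^+ M) (k r) / pf (e * x r) (k r)) *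
     \prod_(r < n) (pf (e * x r) w / pf (e * x r * q ^+ N r) w).
  by rewrite -big_split; apply: eq_bigr => r _ /=; rewrite mulf_div.
have E := vander_partE k.
transitivity ((vander_part k * q ^+ (\sum_(r < n) r.+1 * k r)%N) *
   (box_part k * \prod_(r < n) (pf (e * x r * q ^+ M) (k r) / pf (e * x r) (k r))) *
   (weight_part w * \prod_(r < n) (pf (e * x r) w / pf (e * x r * q ^+ N r) w))).
  by rewrite /weight_part; ring.
rewrite E -/w; ring.
Qed.

(** The numerator parameter [q^(-N_r) / x_r] cuts the sum off at [k_r = N_r]. *)
Lemma rosengren_term_out k r : (N r < k r)%N -> rosengren_term th q x as_ k = 0.
Proof.
move=> h; rewrite /rosengren_term (bigD1 r) //=.
suff -> : rosengren_factor th q x as_ r (k r) = 0 by rewrite mul0r mulr0.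
rewrite /rosengren_factor big_cons big_map.
have -> : \prod_(j < n) pf (q ^- N j / x j * x r) (k r) = 0; last by rewrite mulr0 mul0r.
by rewrite (bigD1 r) //= divfK // (pfact_vanish thP) // mul0r.
Qed.

(** The simplex sum leaves [(q^(-|N|))_w / (q)_w], which completes the remaining factors to
    the summand of the Frenkel-Turaev sum. *)
Lemma weight_layer w : (w <= M)%N ->
  \sum_(k : {ffun 'I_n -> 'I_M.+1} | (\sum_j k j)%N == w) sum_term (fun j => k j) =
  ft_term th q M a b c d w.
Proof.
move=> wM.
transitivity (\sum_(k : {ffun 'I_n -> 'I_M.+1} | (\sum_j k j)%N == w)
   rosengren_term th q x as_ (fun j => k j) *
    (q ^+ w * weight_part w * \prod_(r < n) (pf (e * x r) w / pf (e * x r * q ^+ N r) w))).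
  by apply: eq_bigr => k /eqP kw; rewrite sum_termE kw.
rewrite -mulr_suml (rosengren_sum (M := M) thP q0 x0 as_neq0 size_as) // ?prod_asE //; [|exact: genq].
rewrite big_cons big_map.
have -> : e / (e * q ^+ M) = q ^- M by rewrite invfM mulrA divff // mul1r.
have -> : \prod_(j < n) pf (e / (q ^- N j / x j)) w = \prod_(j < n) pf (e * x j * q ^+ N j) w.
  by apply: eq_bigr => j _; rewrite invfM !invrK; congr (pf _ _); ring.
rewrite prodf_div /weight_part /ft_term /ft_summand /pfacts !big_cons !big_nil.
have -> : b * c * d * q ^- M / a = b * c * d / (a * q ^+ M) by rewrite invfM; ring.
have n1 : \prod_(j < n) pf (e * x j * q ^+ N j) w != 0.
  apply/prodf_neq0 => r _; apply: pfact_neq0 => j jw.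
  rewrite -mulrA -exprD; apply: gene.
  have NM : (N r <= M)%N by rewrite (bigD1 r) //= leq_addr.
  by rewrite mul2n -addnn leq_add // ltnW // (leq_trans jw).
have n2 : \prod_(j < n) pf (e * x j) w != 0.
  apply/prodf_neq0 => r _; apply: pfact_neq0 => j jw; apply: gene.
  by rewrite mul2n -addnn (leq_trans (ltnW jw)) // (leq_trans wM) // leq_addr.
have n3 : pf q w != 0.
  apply: pfact_neq0 => j jw; rewrite -exprS; apply: genq.
  exact: leq_trans jw wM.
rewrite !mulr1 add1n.
move: (\prod_(j < n) _) (\prod_(j < n) _) (pf q w) n1 n2 n3 => P1 P2 P3 n1 n2 n3.
by rewrite -[RHS]mul1r -(divff n1) -[RHS]mul1r -(divff n2) !invfM; ring.
Qed.

Lemma sum_rhsE : sum_rhs = ft_rhs th q M a b c d.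
Proof. by rewrite /sum_rhs /ft_rhs /pfacts !big_cons !big_nil !mulr1 !mulrA. Qed.

Definition box_to_ffun (k : {dffun forall r : 'I_n, 'I_(N r).+1}) : {ffun 'I_n -> 'I_M.+1} :=
  [ffun r => inord (k r)].
Definition ffun_to_box (k : {ffun 'I_n -> 'I_M.+1}) : {dffun forall r : 'I_n, 'I_(N r).+1} :=
  [ffun r => inord (k r)].

Lemma N_le_M r : (N r <= M)%N.
Proof. by rewrite (bigD1 r) //= leq_addr. Qed.

Lemma box_to_ffunE k r : box_to_ffun k r = k r :> nat.
Proof. by rewrite ffunE inordK // ltnS (leq_trans _ (N_le_M r)) // -ltnS. Qed.

Lemma sum_box (F : ('I_n -> nat) -> K) :
  \sum_(k : {dffun forall r : 'I_n, 'I_(N r).+1}) F (fun r => k r) =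
  \sum_(k : {ffun 'I_n -> 'I_M.+1} | [forall r, (k r <= N r)%N]) F (fun r => k r).
Proof.
rewrite [RHS](reindex_onto box_to_ffun ffun_to_box) /=; last first.
  move=> k /forallP h; apply/ffunP => r; apply: val_inj; rewrite /= box_to_ffunE ffunE inordK //.
  by rewrite ltnS.
apply: eq_big => [k|k _]; last by congr F; apply/funext => r; rewrite box_to_ffunE.
symmetry; apply/andP; split.
  by apply/forallP => r; rewrite box_to_ffunE -ltnS.
apply/eqP/ffunP => r; apply: val_inj; rewrite ffunE /= inordK box_to_ffunE //.
Qed.

(** All [k] with [|k| <= |N|] may be added to the box, because the summand vanishes outside
    of it. *)
Lemma sum_layers (F : ('I_n -> nat) -> K) :
  (forall k r, (N r < k r)%N -> (\sum_r k r <= M)%N -> F k = 0) ->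
  \sum_(k : {dffun forall r : 'I_n, 'I_(N r).+1}) F (fun r => k r) =
  \sum_(0 <= w < M.+1) \sum_(k : {ffun 'I_n -> 'I_M.+1} | (\sum_j k j)%N == w) F (fun r => k r).
Proof.
move=> F0; rewrite sum_box big_mkord.
rewrite (partition_big (fun k : {ffun 'I_n -> 'I_M.+1} => inord (\sum_r k r) : 'I_M.+1) xpredT) //=.
apply: eq_bigr => w _; rewrite [RHS](bigID (fun k : {ffun 'I_n -> 'I_M.+1} => [forall r, (k r <= N r)%N])) /=.
rewrite [X in _ = _ + X]big1 ?addr0 => [|k /andP[/eqP kw]]; last first.
  rewrite negb_forall => /existsP [r]; rewrite -ltnNge => h; apply: (F0 _ r) => //.
  by rewrite kw -ltnS.
apply: eq_bigl => k; rewrite andbC; case: forallP => [h|_]; rewrite ?andbF //= !andbT.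
have kM : (\sum_r k r <= M)%N by apply: leq_sum => r _; exact: h.
by rewrite -val_eqE /= inordK.
Qed.

Theorem generic_sum :
  \sum_(k : {dffun forall r : 'I_n, 'I_(N r).+1}) sum_term (fun r => k r) = sum_rhs.
Proof.
rewrite sum_layers => [|k r h wM]; last by rewrite sum_termE // (rosengren_term_out h) mul0r.
rewrite sum_rhsE -(frenkel_turaev_sum thP q0 a0 b0 c0 d0 gena).
by apply: eq_big_nat => w /andP[_ wM]; apply: weight_layer.
Qed.

End GenericSum.

(** * Removing the genericity assumptions *)
Ltac neq0_tac := repeat first [assumption | done | apply: mulf_neq0 | apply: invr_neq0 | apply: expf_neq0].
Ltac tends_tac := repeat first [assumption | exact: tends_cst | apply: tendsX | apply: tendsV; [neq0_tac|] | apply: tendsM].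

Section Continuity.
Variables (K : numFieldType) (th : K -> K).
Hypothesis th_cont : forall u z, z != 0 -> tends u z -> tends (fun m => th (u m)) (th z).

Lemma tendsXz u l (k : int) : l != 0 -> tends u l -> @tends K (fun m => u m ^ k) (l ^ k).
Proof.
case: k => k l0 h; first exact: tendsX.
by rewrite NegzE; apply: tendsV; [apply: expf_neq0 | apply: tendsX].
Qed.

Lemma tends_pfact u v y q k : y != 0 -> q != 0 -> tends u y -> tends v q ->
  tends (fun m => pfact th (v m) (u m) k) (pfact th q y k).
Proof.
move=> y0 q0 hu hv; apply: tends_prod => j _; apply: th_cont; first by neq0_tac.
by tends_tac.
Qed.

Lemma tends_pfacts_nil v q k : tends (fun m => pfacts th (v m) [::] k) (pfacts th q [::] k).
Proof. by rewrite /pfacts big_nil; under eq_fun do rewrite big_nil; exact: tends_cst. Qed.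

Lemma tends_pfacts_cons u v w y q s k : y != 0 -> q != 0 -> tends u y -> tends v q ->
  tends (fun m => pfacts th (v m) (w m) k) (pfacts th q s k) ->
  tends (fun m => pfacts th (v m) (u m :: w m) k) (pfacts th q (y :: s) k).
Proof.
move=> y0 q0 hu hv hw; rewrite /pfacts big_cons.
rewrite [X in tends X](_ : _ = fun m => pfact th (v m) (u m) k * pfacts th (v m) (w m) k).
  by apply: tendsM => //; apply: tends_pfact.
by apply/funext => m; rewrite /pfacts big_cons.
Qed.

Variables (n : nat) (N : 'I_n -> nat) (b c d : K).
Local Notation M := (\sum_(r < n) N r)%N.
Variables (qs as_ es : nat -> K) (xs : 'I_n -> nat -> K) (q a e : K) (x : 'I_n -> K).
Hypotheses (q0 : q != 0) (a0 : a != 0) (b0 : b != 0) (c0 : c != 0) (d0 : d != 0) (e0 : e != 0).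
Hypothesis x0 : forall r, x r != 0.
Hypotheses (qs_q : tends qs q) (as_a : tends as_ a) (es_e : tends es e).
Hypothesis xs_x : forall r, tends (xs r) (x r).

Let x0_tac r : x r != 0 := x0 r.

Lemma tends_sum_rhs :
  pfacts th q [:: a * q / b; a * q / c; a * q / d; a * q / (b * c * d)] M != 0 ->
  tends (fun m => sum_rhs th (qs m) N (as_ m) b c d) (sum_rhs th q N a b c d).
Proof.
move=> den; apply: tendsM; last apply: tendsV => //.
  by do 4 (apply: tends_pfacts_cons; [neq0_tac|done|tends_tac|done|]); exact: tends_pfacts_nil.
by do 4 (apply: tends_pfacts_cons; [neq0_tac|done|tends_tac|done|]); exact: tends_pfacts_nil.
Qed.

Lemma tends_sum_term (k : 'I_n -> nat) (w := (\sum_(r < n) k r)%N) :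
  (forall r s : 'I_n, (r < s)%N -> th (x r / x s) != 0) ->
  (forall r s : 'I_n, pfact th q (q * x r / x s) (k r) != 0) ->
  th a != 0 ->
  pfacts th q [:: a * q ^+ M.+1; a * q / b; a * q / c; a * q / d; b * c * d * q ^- M / a] w != 0 ->
  (forall r : 'I_n, pfact th q (e * x r) (k r) != 0) ->
  (forall r : 'I_n, pfact th q (e * x r * q ^+ N r) w != 0) ->
  tends (fun m => sum_term th (qs m) N (as_ m) b c d (es m) (fun r => xs r m) k)
        (sum_term th q N a b c d e x k).
Proof.
move=> h1 h2 h3 h4 h5 h6.
have xt r : tends (xs r) (x r) by [].
have xn r : x r != 0 by [].
apply: tendsM; last by tends_tac.
apply: tendsM; last first.
  apply: tends_prod => r _; have := xt r; have := xn r => xr0 xr.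
  apply: tendsM; first by apply: tendsM; (apply: tends_pfact; [neq0_tac|done|tends_tac|done]).
  apply: tendsV; first by rewrite mulf_neq0.
  by apply: tendsM; (apply: tends_pfact; [neq0_tac|done|tends_tac|done]).
apply: tendsM; last first.
  apply: tendsM; last apply: tendsV => //.
    by do 5 (apply: tends_pfacts_cons; [neq0_tac|done|tends_tac|done|]); exact: tends_pfacts_nil.
  by do 5 (apply: tends_pfacts_cons; [neq0_tac|done|tends_tac|done|]); exact: tends_pfacts_nil.
apply: tendsM; last first.
  by apply: tendsM; [apply: th_cont; [neq0_tac|tends_tac] | apply: tendsV => //; apply: th_cont].
apply: tendsM.
  apply: tends_prod => r _; apply: tends_prod => s rs.
  have := xt r; have := xn r; have := xt s; have := xn s => xs0 xst xr0 xrt.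
  apply: tendsM; last by apply: tendsV; [exact: h1 | apply: th_cont; [neq0_tac|tends_tac]].
  apply: th_cont; first by do !apply: mulf_neq0; neq0_tac; rewrite expfz_eq0 negb_and q0 orbT.
  by apply: tendsM; [apply: tendsM => //; apply: tendsXz | apply: tendsV].
apply: tends_prod => r _; apply: tends_prod => s _.
have := xt r; have := xn r; have := xt s; have := xn s => xs0 xst xr0 xrt.
apply: tendsM; last apply: tendsV => //.
  by apply: tends_pfact; [neq0_tac|done|tends_tac|done].
by apply: tends_pfact; [neq0_tac|done|tends_tac|done].
Qed.

End Continuity.

Section Perturbation.
Local Open Scope classical_set_scope.
Variables (R : realType) (p : R[i]).
Hypothesis p_lt1 : `|p| < 1.
Local Notation nm := (@ComplexField.Normc.normc R).
Local Notation th := (fun z : R[i] => theta z p).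

Lemma theta_is_theta_like : theta_like th.
Proof.
split; first exact: theta1.
- by move=> z; exact: thetaV.
- exact: theta_three_term.
- by move=> x y; exact: theta_div_eq0.
Qed.

(** A sequence of reals that decreases strictly to 1. *)
Definition pert (m : nat) : R[i] := (1 + (m.+1%:R)^-1)%:C.

Lemma pert_neq0 m : pert m != 0.
Proof.
by rewrite -[0]/((0 : R)%:C) (inj_eq (@complexI R)) gt_eqF // addr_gt0 ?invr_gt0 // ltr0n.
Qed.

Lemma nm_pert_gt1 m l : (0 < l)%N -> 1 < nm (pert m ^+ l).
Proof.
move=> l0; have g1 : 1 < nm (pert m).
  by rewrite nm_real ger0_norm ?addr_ge0 ?invr_ge0 // ltrDl invr_gt0 ltr0n.
by rewrite nmX exprn_egt1 // -lt0n.
Qed.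

Lemma pert_tends : tends pert 1.
Proof.
apply: (@tends_le_nm _ _ _ (fun m => (m.+1%:R)^-1)); last by split; exact: cvg_harmonic.
move=> m; rewrite -nmN opprB /pert rmorphD rmorph1 addrC addKr nm_real ger0_norm //.
Qed.

(** For a real [u > 1] close to 1, neither [u = p^(j+1)] nor [u p^j = 1] is possible. *)
Lemma theta_pert_near1 l : (0 < l)%N -> \forall m \near \oo, theta (pert m ^+ l) p != 0.
Proof.
move=> l0; have /andP[r0 r1] := nm_p01 p_lt1.
have t := tendsX l pert_tends; rewrite expr1n in t.
have d : 0 < 1 - nm p by rewrite subr_gt0.
have [/cvgrPdist_lt/(_ _ d)] := (tends_nmP _ _).1 t.
apply: filterS => m; rewrite sub0r normrN ger0_norm ?nm_ge0 // => h.
have u1 := nm_pert_gt1 m l0; set u := pert m ^+ l in h u1 *.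
have un0 : u != 0 by rewrite expf_neq0 // pert_neq0.
have up : nm u * nm p < 1.
  have : nm u <= nm (1 - u) + nm 1.
    by rewrite -[X in nm X <= _](subrK 1) -[nm (1 - u)]nmN opprB nmD.
  by rewrite nm1; move: (nm u) (nm p) (nm (1 - u)) h r0 r1 => U P V; nra.
apply/negP => /(theta_eq0P p_lt1 un0) [j /orP[/eqP h1|/eqP h1]]; have := congr1 nm h1.
  rewrite nmM nm1 nmX; case: j {h1} => [|j].
    by rewrite expr0 mulr1 => e; rewrite e ltxx in u1.
  rewrite exprS mulrA => e.
  have : nm u * nm p * nm p ^+ j <= nm u * nm p.
    by rewrite ler_piMr ?mulr_ge0 ?nm_ge0 // exprn_ile1 // ltW.
  by rewrite e leNgt up.
rewrite nmX => e.
by move: u1; rewrite e ltNge exprn_ile1 // ltW.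
Qed.

(** If [theta z] is nonzero this is continuity; otherwise a zero at [z g^l] would give, by
    division, a zero at [g^l]. *)
Lemma theta_pert z l : z != 0 -> (0 < l)%N -> \forall m \near \oo, theta (z * pert m ^+ l) p != 0.
Proof.
move=> z0 l0; have [tz|tz] := eqVneq (theta z p) 0; last first.
  apply: (tends_neq0 tz); apply: theta_continuous => //.
  have := tendsM (tends_cst z) (tendsX l pert_tends).
  by rewrite expr1n mulr1.
apply: filterS (theta_pert_near1 l0) => m; apply: contraNneq => h.
have u0 : pert m ^+ l != 0 by rewrite expf_neq0 // pert_neq0.
have zu0 : z * pert m ^+ l != 0 by rewrite mulf_neq0.
by have := theta_div_eq0 p_lt1 zu0 z0 h tz; rewrite mulrC mulKf // => ->.
Qed.

End Perturbation.

Lemma monomial_ratio (K : fieldType) (q g x y : K) i j k l d : g != 0 -> y != 0 -> q != 0 ->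
  (i + k = d + (j + l))%N ->
  (q * g) ^+ i * (x * g ^+ k) / ((q * g) ^+ j * (y * g ^+ l)) = q ^+ i * x / (q ^+ j * y) * g ^+ d.
Proof.
move=> g0 y0 q0 e.
have G : g ^+ i * g ^+ k = g ^+ d * (g ^+ j * g ^+ l) by rewrite -!exprD e.
rewrite !exprMn.
transitivity (q ^+ i * x * (g ^+ i * g ^+ k) / (q ^+ j * y * (g ^+ j * g ^+ l))).
  by congr (_ / _); ring.
by rewrite G; field; rewrite y0 !expf_neq0.
Qed.

Section Monomials.
Variables (K : fieldType) (q g : K).

Lemma monomial_e (e x : K) k i :
  e * g * (x * g ^+ k) * (q * g) ^+ i = e * x * q ^+ i * g ^+ (1 + k + i).
Proof. by rewrite exprMn !exprD expr1; ring. Qed.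

Lemma monomial_a (a : K) l i : a * g ^+ l * (q * g) ^+ i = a * q ^+ i * g ^+ (l + i).
Proof. by rewrite exprMn exprD; ring. Qed.

Lemma monomial_bcd (a z : K) l M i : g != 0 -> q != 0 -> a != 0 -> z != 0 -> (i <= l + M)%N ->
  z * (q * g) ^+ i / (a * g ^+ l * (q * g) ^+ M) = (a * q ^+ M / (z * q ^+ i) * g ^+ (l + M - i))^-1.
Proof.
move=> g0 q0 a0 z0 h; rewrite monomial_a.
rewrite -{1}(subnK h) exprD exprMn; field.
by rewrite !expf_neq0 // a0 z0.
Qed.
End Monomials.

Section Density.
Local Open Scope classical_set_scope.
Variables (R : realType) (p q : R[i]) (n : nat) (N : 'I_n -> nat).
Variables (a b c d e : R[i]) (x : 'I_n -> R[i]).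
Hypotheses (p_lt1 : `|p| < 1) (q0 : q != 0).
Hypotheses (a0 : a != 0) (b0 : b != 0) (c0 : c != 0) (d0 : d != 0) (e0 : e != 0).
Hypothesis x0 : forall r, x r != 0.
Local Notation th := (fun z : R[i] => theta z p).
Local Notation M := (\sum_(r < n) N r)%N.
Local Notation g := (@pert R).

(** The exponents of [g] are chosen such that each monomial in the genericity conditions is
    multiplied by a nonzero power: in [q^i x_r / (q^j x_s)] the step [|N| + 1] between the
    exponents of consecutive [x_r] dominates [i - j], and in [b c d q^i / (a q^|N|)] the
    exponent of [a] dominates [i - |N|]. *)
Definition pert_q m := q * g m.
Definition pert_a m := a * g m ^+ M.+1.
Definition pert_e m := e * g m.
Definition pert_x (r : 'I_n) m := x r * g m ^+ (M.+1 * r).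

Lemma pert_x_generic : \forall m \near \oo, forall r s i j, r != s -> (i <= M)%N -> (j <= M)%N ->
  theta (pert_q m ^+ i * pert_x r m / (pert_q m ^+ j * pert_x s m)) p != 0.
Proof.
have H : \forall m \near \oo, forall i, (i < M.+1)%N -> forall j, (j < M.+1)%N -> forall r s : 'I_n, (s < r)%N ->
    theta (pert_q m ^+ i * pert_x r m / (pert_q m ^+ j * pert_x s m)) p != 0.
  apply: near_ltn => i iM; apply: near_ltn => j jM.
  apply: filter_forall => r; apply: filter_forall => s.
  have [sr|rs] := ltnP s r; last by apply: nearW => m.
  have [l l0 le] : exists2 l, (0 < l)%N & (i + M.+1 * r = l + (j + M.+1 * s))%N.
    have h : (M.+1 * s + M.+1 <= M.+1 * r)%N by rewrite -mulnSr leq_mul2l sr orbT.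
    exists (i + M.+1 * r - (j + M.+1 * s))%N; move: h iM jM; clear; lia.
  have z0 : q ^+ i * x r / (q ^+ j * x s) != 0.
    by apply: mulf_neq0; [apply: mulf_neq0|apply: invr_neq0; apply: mulf_neq0] => //; apply: expf_neq0.
  apply: filterS (theta_pert p_lt1 z0 l0) => m h _.
  by rewrite /pert_q /pert_x (monomial_ratio _ (pert_neq0 _ _) _ _ le).
apply: filterS H => m H r s i j rs iM jM.
have [sr|rs'] := ltnP s r; first exact: H.
have {}rs' : (r < s)%N by rewrite ltn_neqAle rs' andbT val_eqE.
have h := H j jM i iM s r rs'.
have q0' : pert_q m != 0 by apply: mulf_neq0 => //; exact: pert_neq0.
have x0' t : pert_x t m != 0 by apply: mulf_neq0 => //; apply: expf_neq0; exact: pert_neq0.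
rewrite -invf_div; apply: (th_inv_neq0 (theta_is_theta_like p_lt1)) => //.
by apply: mulf_neq0; [apply: mulf_neq0|apply: invr_neq0; apply: mulf_neq0] => //; apply: expf_neq0.
Qed.

Lemma pert_e_generic : \forall m \near \oo, forall i r, (i <= 2 * M)%N ->
  theta (pert_e m * pert_x r m * pert_q m ^+ i) p != 0.
Proof.
have : \forall m \near \oo, forall i, (i < (2 * M).+1)%N -> forall r,
  theta (pert_e m * pert_x r m * pert_q m ^+ i) p != 0.
  apply: near_ltn => i iM; apply: filter_forall => r.
  have z0 : e * x r * q ^+ i != 0 by apply: mulf_neq0; [apply: mulf_neq0|apply: expf_neq0].
  have l0 : (0 < 1 + M.+1 * r + i)%N by [].
  apply: filterS (theta_pert p_lt1 z0 l0) => m.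
  by rewrite -monomial_e.
by apply: filterS => m H i r iM; apply: H.
Qed.

Lemma pert_a_generic : \forall m \near \oo, ft_generic th (pert_q m) M (pert_a m) b c d.
Proof.
have H1 y : y != 0 -> \forall m \near \oo, forall i, (i < (2 * M).+1)%N -> theta (pert_a m * pert_q m ^+ i / y) p != 0.
  move=> y0; apply: near_ltn => i iM.
  have z0 : a * q ^+ i / y != 0.
    by apply: mulf_neq0; [apply: mulf_neq0 => //; apply: expf_neq0|apply: invr_neq0].
  have l0 : (0 < M.+1 + i)%N by [].
  apply: filterS (theta_pert p_lt1 z0 l0) => m.
  by rewrite /pert_a /pert_q monomial_a mulrAC.
have H2 : \forall m \near \oo, forall i, (i < M.+1)%N -> (0 < i)%N -> theta (pert_q m ^+ i) p != 0.
  apply: near_ltn => i iM; have [->|i0] := posnP i; first by apply: nearW => m.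
  have z0 : q ^+ i != 0 by apply: expf_neq0.
  by apply: filterS (theta_pert p_lt1 z0 i0) => m; rewrite /pert_q exprMn.
have bcd0 : b * c * d != 0 by apply: mulf_neq0; [apply: mulf_neq0|].
have H3 : \forall m \near \oo, forall i, (i < (2 * M).+1)%N ->
    theta (b * c * d * pert_q m ^+ i / (pert_a m * pert_q m ^+ M)) p != 0.
  apply: near_ltn => i iM.
  have iM' : (i <= M.+1 + M)%N by move: iM; clear; lia.
  have l0 : (0 < M.+1 + M - i)%N by move: iM; clear; lia.
  have z0 : a * q ^+ M / (b * c * d * q ^+ i) != 0.
    by apply: mulf_neq0; [apply: mulf_neq0|apply: invr_neq0; apply: mulf_neq0] => //; apply: expf_neq0.
  apply: filterS (theta_pert p_lt1 z0 l0) => m h.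
  rewrite /pert_a /pert_q (monomial_bcd (pert_neq0 R m) q0 a0 bcd0 iM').
  apply: (th_inv_neq0 (theta_is_theta_like p_lt1)) => //.
  by apply: mulf_neq0 => //; apply: expf_neq0; exact: pert_neq0.
have le i : (0 < i <= M)%N -> (i < (2 * M).+1)%N by clear; lia.
have Hbcd : \forall m \near \oo, forall i, (0 < i <= M)%N ->
    [/\ theta (pert_a m * pert_q m ^+ i / b) p != 0, theta (pert_a m * pert_q m ^+ i / c) p != 0 &
        theta (pert_a m * pert_q m ^+ i / d) p != 0].
  by apply: filterS3 (H1 _ b0) (H1 _ c0) (H1 _ d0) => m Gb Gc Gd i /le iM; split; [apply: Gb|apply: Gc|apply: Gd].
apply: filterS3 (filterI Hbcd H2) (H1 _ (oner_neq0 _)) H3 => m [Gb G2] G1 G3.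
split=> // [i iM|i /andP[i0 iM]].
  by have := G1 i iM; rewrite divr1.
exact: G2.
Qed.

Lemma pert_sum : \forall m \near \oo,
  \sum_(k : {dffun forall r : 'I_n, 'I_(N r).+1})
     sum_term th (pert_q m) N (pert_a m) b c d (pert_e m) (fun r => pert_x r m) (fun r => k r) =
  sum_rhs th (pert_q m) N (pert_a m) b c d.
Proof.
apply: filterS3 pert_a_generic pert_x_generic pert_e_generic => m Ha Hx He.
have g0 := @pert_neq0 R m.
apply: (generic_sum (theta_is_theta_like p_lt1)) => //.
- exact: mulf_neq0.
- by apply: mulf_neq0 => //; apply: expf_neq0.
- exact: mulf_neq0.
- by move=> r; apply: mulf_neq0 => //; apply: expf_neq0.
Qed.

Lemma pert_tends_to z l : tends (fun m => z * g m ^+ l) z.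
Proof.
have := tendsM (tends_cst z) (tendsX l (@pert_tends R)).
by rewrite expr1n mulr1.
Qed.

Theorem sum_by_density :
  (forall r s : 'I_n, (r < s)%N -> theta (x r / x s) p != 0) ->
  (forall (r s : 'I_n) k, (k <= N r)%N -> pfact th q (q * x r / x s) k != 0) ->
  theta a p != 0 ->
  (forall k, (k <= M)%N ->
     pfacts th q [:: a * q ^+ M.+1; a * q / b; a * q / c; a * q / d; b * c * d * q ^- M / a] k != 0) ->
  (forall (r : 'I_n) k, (k <= N r)%N -> pfact th q (e * x r) k != 0) ->
  (forall (r : 'I_n) k, (k <= M)%N -> pfact th q (e * x r * q ^+ N r) k != 0) ->
  pfacts th q [:: a * q / b; a * q / c; a * q / d; a * q / (b * c * d)] M != 0 ->
  \sum_(k : {dffun forall r : 'I_n, 'I_(N r).+1}) sum_term th q N a b c d e x (fun r => k r) =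
  sum_rhs th q N a b c d.
Proof.
move=> den_x den_qx den_a den_abcd den_ex den_exN den_rhs.
have cont u z : z != 0 -> tends u z -> tends (fun m => th (u m)) (th z).
  exact: theta_continuous.
have hq : tends pert_q q by exact: (pert_tends_to q 1).
have ha : tends pert_a a by exact: pert_tends_to.
have he : tends pert_e e by exact: (pert_tends_to e 1).
have hx r : tends (pert_x r) (x r) by exact: pert_tends_to.
have R_cvg := tends_sum_rhs cont q0 a0 b0 c0 d0 hq ha den_rhs.
apply: tends_unique R_cvg; apply: tends_near pert_sum _.
apply: tends_sum => k _; apply: tends_sum_term => //.
- by move=> r s; apply: den_qx; rewrite -ltnS.
- by apply: den_abcd; apply: leq_sum => r _; rewrite -ltnS.
- by move=> r; apply: den_ex; rewrite -ltnS.
- by move=> r; apply: den_exN; apply: leq_sum => s _; rewrite -ltnS.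
Qed.
End Density.

Theorem theorem11p3 (R : realType) (q p : R[i]) (n : nat) (N : 'I_n -> nat)
    (a b c d e : R[i]) (x : 'I_n -> R[i])
    (q_neq0 : q != 0) (p_lt1 : `|p| < 1) (n_ge1 : (1 <= n)%N)
    (a_neq0 : a != 0) (b_neq0 : b != 0) (c_neq0 : c != 0) (d_neq0 : d != 0)
    (e_neq0 : e != 0) (x_neq0 : forall r, x r != 0)
    (* no denominator occurring in the formula vanishes *)
    (den_x : forall r s : 'I_n, (r < s)%N -> theta (x r / x s) p != 0)
    (den_qx : forall (r s : 'I_n) (k : nat), (k <= N r)%N ->
       qpfact (q * x r / x s) q p k != 0)
    (den_a : theta a p != 0)
    (den_abcd : forall k : nat, (k <= weight N)%N ->
       qpfacts [:: a * q ^+ (weight N).+1; a * q / b; a * q / c; a * q / d;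
                   b * c * d * q ^- weight N / a] q p k != 0)
    (den_ex : forall (r : 'I_n) (k : nat), (k <= N r)%N ->
       qpfact (e * x r) q p k != 0)
    (den_exN : forall (r : 'I_n) (k : nat), (k <= weight N)%N ->
       qpfact (e * x r * q ^+ N r) q p k != 0)
    (den_rhs : qpfacts [:: a * q / b; a * q / c; a * q / d;
                           a * q / (b * c * d)] q p (weight N) != 0) :
  \sum_(k : {dffun forall r : 'I_n, 'I_(N r).+1})
    ((\prod_(r < n) \prod_(s < n | (r < s)%N)
        (theta (q ^ ((k r)%:Z - (k s)%:Z) * x r / x s) p
           / theta (x r / x s) p))
     * (\prod_(r < n) \prod_(s < n)
        (qpfact (q ^- N s * x r / x s) q p (k r)
           / qpfact (q * x r / x s) q p (k r)))
     * (theta (a * q ^+ (2 * weight (fun r => k r))) p / theta a p)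
     * (qpfacts [:: a; b; c; d; a ^+ 2 * q ^+ (1 + weight N) / (b * c * d)]
          q p (weight (fun r => k r))
        / qpfacts [:: a * q ^+ (weight N).+1; a * q / b; a * q / c; a * q / d;
                      b * c * d * q ^- weight N / a] q p (weight (fun r => k r)))
     * (\prod_(r < n)
        ((qpfact (e * x r * q ^+ weight N) q p (k r)
            * qpfact (e * x r) q p (weight (fun r => k r)))
         / (qpfact (e * x r) q p (k r)
            * qpfact (e * x r * q ^+ N r) q p (weight (fun r => k r)))))
     * q ^+ (\sum_(r < n) r.+1 * k r)%N)
  = qpfacts [:: a * q; a * q / (b * c); a * q / (b * d); a * q / (c * d)]
      q p (weight N)
    / qpfacts [:: a * q / b; a * q / c; a * q / d; a * q / (b * c * d)]
        q p (weight N).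
Proof.
exact: (sum_by_density p_lt1 q_neq0 a_neq0 b_neq0 c_neq0 d_neq0 e_neq0 x_neq0
  den_x den_qx den_a den_abcd den_ex den_exN den_rhs).
Qed.
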